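(* (1) A strongly minimal infinite linear space in the one-sorted vocabulary $\tau=\{R\}$ is (with its lines as blocks) a $(v,K,1)$-PBD for some finite set $K$ of positive integers. (2) For each integer $k$ with $3\le k<\omega$ there are continuum many ($2^{\aleph_0}$-many) strongly minimal infinite linear spaces in the vocabulary $\tau$, with pairwise distinct complete first-order theories, that are Steiner $k$-systems.
   Context: The vocabulary $\tau$ consists of one ternary relation symbol $R$. A linear space in $\tau$ is a $\tau$-structure in which $R$ holds only of triples of pairwise distinct elements, $R$ is invariant under permutations of its arguments, and $R(x,y,z)\wedge R(x,y,w)\wedge z\neq w\rightarrow R(x,w,z)$ ($R$ is collinearity). A line of $M$ is either a pair $\{a,b\}$ of distinct points such that $R(a,b,c)$ for no $c\in M$ (a trivial line), or a maximal $R$-clique with at least $3$ elements (a non-trivial line). Each pair of distinct points lies on exactly one line. A structure $M$ is strongly minimal if it is infinite and in every elementary extension $N$ of $M$ each subset of $N$ definable with parameters is finite or cofinite. A $(v,K,\lambda)$-PBD (pairwise balanced design), for $\lambda>0$ an integer and $K$ a set of positive integers, is a set $X$ with $|X|=v$ (here $v$ may be infinite) and a family of subsets of $X$ (blocks) such that the size of every block belongs to $K$ and every two-element subset of $X$ is contained in exactly $\lambda$ blocks. A Steiner $k$-system is a $(v,\{k\},1)$-PBD; for a linear space this means that every line has exactly $k$ points.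
   Formalization: In (1) the space is also assumed to have no line containing all but finitely many of its points; without this (1) fails, e.g. for an infinite set in which all triples of distinct points are collinear. *)

(* Defs.v *)
From mathcomp Require Import all_boot.
From mathcomp Require Import boolp classical_sets functions cardinality.

Set Implicit Arguments.
Unset Strict Implicit.
Unset Printing Implicit Defensive.

Local Open Scope classical_set_scope.
Local Open Scope card_scope.

Record structure := Structure {
  carrier :> Type;
  coll : carrier -> carrier -> carrier -> Prop }.

(* First-order formulas over {R}, well scoped: the free variables of a
   [formula n] are among the n variables indexed by 'I_n.  In [FEx f] the bound
   variable is ord0, and variable i of the context becomes [lift ord0 i]. *)
Inductive formula (n : nat) : Type :=
| FEq of 'I_n & 'I_n
| FRel of 'I_n & 'I_n & 'I_n
| FNot of formula n
| FAnd of formula n & formula n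
| FEx of formula n.+1.

Definition scons (T : Type) (n : nat) (a : T) (v : 'I_n -> T) : 'I_n.+1 -> T :=
  fun i => if unlift ord0 i is Some j then v j else a.

Fixpoint sat (M : structure) (n : nat) (f : formula n) : ('I_n -> M) -> Prop :=
  match f with
  | FEq i j => fun v => v i = v j
  | FRel i j k => fun v => coll (v i) (v j) (v k)
  | FNot g => fun v => ~ sat g v
  | FAnd g h => fun v => sat g v /\ sat h v
  | FEx g => fun v => exists a : M, sat g (scons a v)
  end.

Definition sentence := formula 0.

Definition theory (M : structure) : set sentence :=
  [set f | forall v : 'I_0 -> M, sat f v].

(* An elementary extension of M is a structure N together with an elementary
   embedding of M into N. *)
Definition elementary (M N : structure) (h : M -> N) : Prop :=
  forall (n : nat) (f : formula n) (v : 'I_n -> M),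
    sat f v <-> sat f (fun i => h (v i)).

Definition definable (N : structure) (D : set N) : Prop :=
  exists (n : nat) (f : formula n.+1) (p : 'I_n -> N),
    D = [set a | sat f (scons a p)].

Definition strongly_minimal (M : structure) : Prop :=
  infinite_set [set: M] /\
  forall (N : structure) (h : M -> N), elementary h ->
    forall D : set N, definable D -> finite_set D \/ cofinite_set D.

Definition linear_space (M : structure) : Prop :=
  [/\ forall x y z : M, coll x y z -> [/\ x <> y, x <> z & y <> z],
      forall x y z : M, coll x y z ->
        [/\ coll x z y, coll y x z, coll y z x, coll z x y & coll z y x] &
      forall x y z w : M, coll x y z -> coll x y w -> z <> w -> coll x w z].

Definition clique (M : structure) (C : set M) : Prop :=
  forall x y z : M, C x -> C y -> C z ->
    x <> y -> x <> z -> y <> z -> coll x y z.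

Definition trivial_line (M : structure) (l : set M) : Prop :=
  exists a b : M,
    [/\ a <> b, l = [set a; b] & forall c : M, ~ coll a b c].

Definition nontrivial_line (M : structure) (l : set M) : Prop :=
  [/\ `I_3 #<= l, clique l &
      forall C : set M, clique C -> l `<=` C -> C = l].

Definition lines (M : structure) : set (set M) :=
  [set l | trivial_line l \/ nontrivial_line l].

(* Degenerate spaces have a line containing all but finitely many points: a
   single infinite line, or an infinite line with finitely many points off it.
   They can be strongly minimal, for instance an infinite set in which all
   triples of distinct points are collinear, but have a block of infinite size
   and hence are not PBDs with block sizes in a set of positive integers. *)
Definition no_cofinite_line (M : structure) : Prop :=
  forall l : set M, lines l -> ~ cofinite_set l.

(* (v, K, lambda)-PBD on the point set X; the possibly infinite cardinal v is
   represented by a type V of that cardinality. *)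
Definition pbd (V : Type) (K : set nat) (lambda : nat)
    (X : Type) (blocks : set (set X)) : Prop :=
  [/\ (0 < lambda)%N,
      forall k : nat, K k -> (0 < k)%N,
      [set: X] #= [set: V],
      forall b : set X, blocks b -> exists2 k : nat, K k & b #= `I_k &
      forall p : set X, p #= `I_2 ->
        [set b | blocks b /\ p `<=` b] #= `I_lambda].

Definition steiner (k : nat) (X : Type) (blocks : set (set X)) : Prop :=
  exists V : Type, pbd V [set k] 1 blocks.

(* Main.v *)
Require Import Defs.
From mathcomp Require Import all_boot.
From mathcomp Require Import boolp classical_sets functions cardinality.
From mathcomp Require Import filter finmap zify.

(* Write k = w + 2 and give a finite set X of points the predimension
   |X| - w * (number of blocks contained in X).  Hrushovski's construction is
   run on the partial Steiner k-systems of hereditarily nonnegative predimension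
   in which every 0-primitive extension has at most mu p disjoint copies over
   its base, p being the size of the base.  The generic structure is a union of
   finite stages on the points nat: a stage adds a fresh copy of an extension
   whenever the result stays in the class.  If it does not, submodularity and
   mu p >= p + 2 show that the obstruction consists of copies of the very
   extension, so that it is already realised.  Hence every 0-primitive extension
   of a self-sufficient set is realised, which yields a back-and-forth between
   finite self-sufficient sets.  A formula is decided already by sets that are
   self-sufficient up to a fixed number of new points, and only boundedly many
   points fail to be generic over such a set; this bounds definable sets or their
   complements uniformly inside the structure, and a uniform bound passes to
   elementary extensions.  The extension formed by a cycle of l blocks has a base
   of size l and exactly mu l disjoint copies, so mu can be read off the theory.

   For the first part, an ultrapower of a linear space with unbounded finite
   lines has an infinite line with infinite complement. *)

Set Implicit Arguments.
Unset Strict Implicit.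
Unset Printing Implicit Defensive.

(** * Formulas and elementary extensions *)

Section Logic.
Implicit Types (M N : structure).

(** The weight w is dictated by k: a block through two given points brings w new ones, at a
    dimension of w - w = 0. A block on an unjoined pair is thus a 0-primitive extension, so every
    pair ends up on a block of exactly w + 2 points, and this makes the generic structure a Steiner
    system. For the same reason extensions with a block through two old points need separate
    treatment: a joined pair admits no second block.

    The bound mu p >= p + 2 serves twice. More than p copies exceed what a base of p points can pay
    for, and the surplus yields several distinct blocks through one point of the base, too many for
    a single block or for a cycle.

    Full self-sufficiency amounts to infinitely many conditions, hence the truncation at m new
    points. The order of quantifiers is delicate: the level may depend on the formula but not on the
    size of the set, which grows during the game and with the hull.

    Reading mu off the theory needs mu l copies of a cycle to exist. They come from a refusal: when
    a further copy cannot be added, the copies that forbid it, less the refused one, are in the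
    structure already. *)

Definition lift_ren n m (r : 'I_n -> 'I_m) : 'I_n.+1 -> 'I_m.+1 :=
  fun i => if unlift ord0 i is Some j then lift ord0 (r j) else ord0.

Fixpoint ren n (f : formula n) : forall m, ('I_n -> 'I_m) -> formula m :=
  match f with
  | FEq i j => fun _ r => FEq (r i) (r j)
  | FRel i j k => fun _ r => FRel (r i) (r j) (r k)
  | FNot g => fun _ r => FNot (ren g r)
  | FAnd g h => fun _ r => FAnd (ren g r) (ren h r)
  | FEx g => fun _ r => FEx (ren g (lift_ren r))
  end.

Lemma scons_comp (T U : Type) n (h : T -> U) (a : T) (v : 'I_n -> T) :
  h \o scons a v = scons (h a) (h \o v).
Proof. by apply: funext => i; rewrite /scons /=; case: unlift. Qed.

Lemma sat_ren M n (f : formula n) m (r : 'I_n -> 'I_m) (v : 'I_m -> M) :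
  sat (ren f r) v <-> sat f (v \o r).
Proof.
elim: f m r v => {n} [n i j|n i j k|n g IH|n g IHg h IHh|n g IH] m r v //=.
- by rewrite IH.
- by rewrite IHg IHh.
have eqv a : scons a v \o lift_ren r = scons a (v \o r).
  apply: funext => i; rewrite /scons /lift_ren /=; case: (unliftP ord0 i) => [j|] _.
    by rewrite liftK.
  by rewrite unlift_none.
by split=> -[a]; [rewrite IH eqv | rewrite -eqv -IH]; exists a.
Qed.

Definition FTrue n : formula n := FNot (FEx (FNot (FEq ord0 ord0))).

Definition conj n (I : Type) (s : seq I) (F : I -> formula n) : formula n :=
  foldr (fun i f => FAnd (F i) f) (FTrue n) s.

Lemma sat_conj M n (I : eqType) (s : seq I) (F : I -> formula n) (v : 'I_n -> M) :
  sat (conj s F) v <-> forall i, i \in s -> sat (F i) v.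
Proof.
elim: s => [|i s IH] /=; first by split=> // _ [a]; apply.
rewrite IH; split=> [[Fi Fs] j|H].
  by rewrite inE => /predU1P[->//|/Fs].
by split=> [|j js]; apply: H; rewrite inE ?eqxx ?js ?orbT.
Qed.

Fixpoint exs r n : formula (r + n) -> formula n :=
  match r return formula (r + n) -> formula n with
  | 0 => fun f => f
  | r'.+1 => fun f => exs (FEx f : formula (r' + n))
  end.

Definition cat_val (T : Type) r n (x : 'I_r -> T) (p : 'I_n -> T) : 'I_(r + n) -> T :=
  fun i => match fintype.split i with inl j => x j | inr j => p j end.

Lemma cat_valS (T : Type) r n (x : 'I_r.+1 -> T) (p : 'I_n -> T) :
  cat_val x p = scons (x ord0) (cat_val (x \o lift ord0) p) :> ('I_(r + n).+1 -> T).
Proof.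
apply: funext => i; rewrite /scons; case: (unliftP ord0 i) => [j|] ->; rewrite /cat_val.
- case: (splitP j) => k jk.
    case: splitP => l /= jl; first by congr x; apply: val_inj; rewrite /= -jl /= jk.
    by have := ltn_ord k; rewrite -jk; move: jl; rewrite /bump /=; lia.
  case: splitP => l /= jl.
    by have := ltn_ord l; move: jl; rewrite /bump /= jk; lia.
  congr p; apply: val_inj; move: jl; rewrite /bump /= jk; lia.
- case: splitP => l /= jl; last by lia.
  by congr x; apply: val_inj.
Qed.

Lemma sat_exs M r n (f : formula (r + n)) (p : 'I_n -> M) :
  sat (exs f) p <-> exists x : 'I_r -> M, sat f (cat_val x p).
Proof.
elim: r f => [|r IH] f /=.
  have eqp (x : 'I_0 -> M) : (cat_val x p : 'I_n -> M) = p.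
    apply: funext => i; rewrite /cat_val; case: splitP => [[]//|j /= ij].
    by congr p; apply: val_inj.
  split=> [Sf|[x]]; last by rewrite eqp.
  have x : 'I_0 -> M by case.
  by exists x; rewrite eqp.
rewrite IH; split=> [[x [a]]|[x]].
  pose y : 'I_r.+1 -> M := fun i => if unlift ord0 i is Some j then x j else a.
  exists y; rewrite cat_valS /y unlift_none.
  suff -> : (fun i => if unlift ord0 i is Some j then x j else a) \o lift ord0 = x by [].
  by apply: funext => i /=; rewrite liftK.
by rewrite cat_valS => Sf; exists (x \o lift ord0), (x ord0).
Qed.

Lemma cat_val_l (T : Type) r n (x : 'I_r -> T) (p : 'I_n -> T) i :
  cat_val x p (lshift n i) = x i.
Proof. by rewrite /cat_val -[lshift n i]/(unsplit (inl i)) unsplitK. Qed.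

Lemma cat_val_r (T : Type) r n (x : 'I_r -> T) (p : 'I_n -> T) i :
  cat_val x p (rshift r i) = p i.
Proof. by rewrite /cat_val -[rshift r i]/(unsplit (inr i)) unsplitK. Qed.

Definition at_least r n (f : formula n.+1) : formula n :=
  exs (FAnd
    (conj (enum {: 'I_r * 'I_r}) (fun ij => if ij.1 == ij.2 then FTrue _
       else FNot (FEq (lshift n ij.1) (lshift n ij.2))))
    (conj (enum 'I_r) (fun i => ren f (scons (lshift n i) (@rshift r n))))).

Lemma sat_at_least M r n (f : formula n.+1) (p : 'I_n -> M) :
  sat (at_least r f) p <->
  exists2 x : 'I_r -> M, injective x & forall i, sat f (scons (x i) p).
Proof.
have eqv (x : 'I_r -> M) i :
    cat_val x p \o scons (lshift n i) (@rshift r n) = scons (x i) p.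
  rewrite scons_comp cat_val_l; congr (scons _ _).
  by apply: funext => j /=; rewrite cat_val_r.
rewrite sat_exs; split=> [[x [/sat_conj xi /sat_conj xf]]|[x xi xf]]; exists x.
- move=> i j eqx; apply/eqP; apply: contraT => neq.
  have := xi (i, j); rewrite mem_enum (negbTE neq) /= !cat_val_l => /(_ isT) []//.
- by move=> i; rewrite -eqv -sat_ren; apply: xf; rewrite mem_enum.
split; apply/sat_conj; last by move=> i _; rewrite sat_ren eqv.
move=> [i j] _ /=; case: eqP => [_ [a]|neq /=]; first by apply.
by rewrite !cat_val_l => /xi.
Qed.

Definition literal M n (f : formula n) (v : 'I_n -> M) : formula n :=
  if `[< sat f v >] then f else FNot f.

Lemma sat_literal M N n (f : formula n) (v : 'I_n -> M) (u : 'I_n -> N) :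
  sat (literal f v) u <-> (sat f v <-> sat f u).
Proof. by rewrite /literal; case: asboolP => /= ?; tauto. Qed.

(** The diagram of finitely many points is a finite conjunction of literals; closed by existential
    quantifiers it is a sentence. *)
Lemma theory_diagram M N n (u : 'I_n -> M) : theory M = theory N ->
  exists v : 'I_n -> N, (forall i j, u i = u j <-> v i = v j) /\
    (forall i j k, coll (u i) (u j) (u k) <-> coll (v i) (v j) (v k)).
Proof.
move=> thMN; pose o (i : 'I_n) : 'I_(n + 0) := lshift 0 i.
have p M' : 'I_0 -> M' by case.
pose w := cat_val u (p M).
pose f := exs (FAnd
  (conj (enum {: 'I_n * 'I_n}) (fun i => literal (FEq (o i.1) (o i.2)) w))
  (conj (enum {: 'I_n * 'I_n * 'I_n})
     (fun i => literal (FRel (o i.1.1) (o i.1.2) (o i.2)) w))).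
have Mf : theory M f.
  move=> q; rewrite sat_exs; exists u; have -> : q = p M by apply: funext => -[].
  by split; apply/sat_conj => i _; apply/sat_literal.
rewrite thMN in Mf; have := Mf (p N); rewrite sat_exs => -[v [/sat_conj vE /sat_conj vR]].
exists v; split=> [i j|i j k].
  have /sat_literal := vE (i, j) (mem_enum _ _).
  by rewrite /= /w !cat_val_l.
have /sat_literal := vR (i, j, k) (mem_enum _ _).
by rewrite /= /w !cat_val_l.
Qed.

Lemma strongly_minimal_of_uniform M : infinite_set [set: M]%classic ->
  (forall n (f : formula n.+1), exists c, forall p : 'I_n -> M,
     ~ (sat (at_least c f) p /\ sat (at_least c (FNot f)) p)) ->
  strongly_minimal M.
Proof.
move=> Minf H; split=> // N h el D [n [f [p ->]]].
have [c Hc] := H n f.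
(* The parameters of D lie in N, so they are quantified away as well: the failure of the bound
   becomes one sentence, false in M and hence in N. The renaming only moves b to the context n + 0
   that [exs] expects. *)
pose b : formula n := FAnd (at_least c f) (at_least c (FNot f)).
pose g : formula 0 := exs (ren b (lshift 0)).
have p0 M' : 'I_0 -> M' by case.
have Mg : ~ sat g (p0 M).
  rewrite sat_exs => -[x]; rewrite sat_ren => -[b1 b2].
  by apply: (Hc (cat_val x (p0 M) \o lshift 0)).
have big (A : set N) : infinite_set A -> exists2 x : 'I_c -> N, injective x & forall i, A (x i).
  move=> /infiniteP/card_leP/unsquash q; exists (fun i => val (q (to_setT (val i)))) => [i j|i].
    move=> /val_inj eqx; apply: val_inj; suff : to_setT (val i) = to_setT (val j) by case.
    by apply: inj eqx; exact: mem_setT.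
  exact: set_valP.
apply: contrapT => /not_orP[/big[x xi xD] /big[y yi yD]].
apply: Mg; rewrite el sat_exs; exists p.
rewrite sat_ren; have -> : cat_val p (fun i => h (p0 M i)) \o lshift 0 = p.
  by apply: funext => i /=; rewrite cat_val_l.
split; apply/sat_at_least; first by exists x.
by exists y.
Qed.

End Logic.

(** * Lines and strongly minimal linear spaces *)

Section Cardinals.
Local Open Scope classical_set_scope.
Local Open Scope card_scope.
Variable T : Type.
Implicit Types A : set T.

Lemma card_ge_inj c A : `I_c #<= A -> exists2 x : 'I_c -> T, injective x & forall i, A (x i).
Proof.
have [-> _|c0] := posnP c.
  have x : 'I_0 -> T by case.
  by exists x => -[].
move=> /card_leP/unsquash q.
have ltc (i : 'I_c) : `I_c (val i) by exact: ltn_ord.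
pose i0 := fun i : 'I_c => SigSub (mem_set (ltc i)) : `I_c.
exists (fun i => val (q (i0 i))) => [i j|i]; last exact: set_valP.
move=> /val_inj eqx; apply: val_inj; suff : i0 i = i0 j by move=> [].
by apply: inj eqx; exact: mem_setT.
Qed.

Lemma card_range_ord c (x : 'I_c -> T) : injective x -> range x #= `I_c.
Proof.
move=> xi; have eqx : range x #= [set: 'I_c] by apply: inj_card_eq => i j _ _; exact: xi.
by rewrite (card_eql eqx) card_eq_sym card_II.
Qed.

Lemma inj_card_ge c A (x : 'I_c -> T) : injective x -> (forall i, A (x i)) -> `I_c #<= A.
Proof.
move=> xi xA; rewrite -(card_le_eql (card_range_ord xi)).
by apply: subset_card_le => _ [i _ <-]; exact: xA.
Qed.

Lemma card_eq_range c A : A #= `I_c -> exists2 x : 'I_c -> T, injective x & A = range x.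
Proof.
move=> Ac; have [|x xi xA] := @card_ge_inj c A; first by rewrite (card_le_eqr Ac).
exists x => //; apply/seteqP; split=> [a Aa|_ [i _ <-]]; last exact: xA.
apply: contrapT => nax.
pose y (i : 'I_c.+1) := if unlift ord0 i is Some j then x j else a.
have yi : injective y.
  move=> i j; rewrite /y; case: (unliftP ord0 i) => [i'|] ->; case: (unliftP ord0 j) => [j'|] -> //.
  - by move=> /xi ->.
  - by move=> eqa; case: nax; exists i'.
  - by move=> eqa; case: nax; exists j'.
have := @inj_card_ge c.+1 A y yi; rewrite (card_le_eqr Ac) card_le_II ltnn.
by move=> H; suff : false by []; apply: H => i; rewrite /y; case: unlift.
Qed.

Lemma finite_few A c : A #= `I_c -> forall x : 'I_c.+1 -> T, injective x -> ~ (forall i, A (x i)).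
Proof. by move=> Ac x xi xA; have := inj_card_ge xi xA; rewrite (card_le_eqr Ac) card_le_II ltnn. Qed.

End Cardinals.

Section Lines.
Local Open Scope classical_set_scope.
Local Open Scope card_scope.
Variable M : structure.
Hypothesis LM : linear_space M.
Implicit Types (a b p x y z : M) (l : set M).

Definition line a b : set M := [set x | [\/ x = a, x = b | coll a b x]].

Lemma line_sym a b : line a b = line b a.
Proof.
have [_ sym _] := LM.
apply/seteqP; split=> x [->|->|/sym[_ c _ _ _]]; by [constructor 1|constructor 2|constructor 3].
Qed.

Lemma line_move_sub a b p : line a b p -> p <> a -> line a b `<=` line a p.
Proof.
have [_ sym ex] := LM; move=> lp pa; case: lp => [//|-> //|abp] x [->|->|abx].
- by constructor 1.
- by constructor 3; have [] := sym _ _ _ abp.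
have [->|xp] := pselect (x = p); first by constructor 2.
by constructor 3; exact: ex abx abp xp.
Qed.

Lemma line_move a b p : a <> b -> line a b p -> p <> a -> line a p = line a b.
Proof.
have [_ sym _] := LM; move=> ab abp pa; apply/seteqP; split; last exact: line_move_sub.
apply: line_move_sub (nesym ab); case: abp => [//|->|/sym[c _ _ _ _]]; first by constructor 2.
by constructor 3.
Qed.

Lemma line_eq a b x y : a <> b -> line a b x -> line a b y -> x <> y -> line x y = line a b.
Proof.
move=> ab lx ly xy.
have [xa|xa] := pselect (x = a).
  by rewrite xa; apply: (line_move ab ly) => ya; apply: xy; rewrite xa ya.
have eqx := line_move ab lx xa; rewrite line_sym in eqx.
by rewrite -eqx; apply: line_move => //; [rewrite eqx | exact: nesym].
Qed.

Lemma line_clique a b : a <> b -> clique (line a b).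
Proof.
move=> ab x y z lx ly lz xy xz yz.
by move: lz; rewrite -(line_eq ab lx ly xy) => -[zx|zy|//]; [case: xz|case: yz].
Qed.

(** A maximal clique with three points is spanned by any two of them, because [line a b] is itself a
    clique. Both kinds of line thus get one uniform description. *)
Lemma linesP l : lines l <-> exists a b, a <> b /\ l = line a b.
Proof.
split=> [[[a [b [ab -> nc]]]|[l3 lcl lmax]]|[a [b [ab ->]]]].
- exists a, b; split=> //; apply/seteqP; split=> x.
    by case=> [->|->]; [constructor 1|constructor 2].
  by case=> [->|->|/nc]; [left|right|].
- have [x xi xl] := card_ge_inj l3.
  pose i0 : 'I_3 := ord0; pose i1 : 'I_3 := lift ord0 ord0.
  have ab : x i0 <> x i1 by move=> /xi.
  exists (x i0), (x i1); split=> //; apply/esym/lmax; first exact: line_clique.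
  move=> y ly; have [->|y0] := pselect (y = x i0); first by constructor 1.
  have [->|y1] := pselect (y = x i1); first by constructor 2.
  by constructor 3; apply: lcl => //; apply: nesym.
case: (pselect (exists c, coll a b c)) => [[c abc]|nc]; last first.
  left; exists a, b; split=> // [|c abc]; last by apply: nc; exists c.
  apply/seteqP; split=> x; last by case=> [->|->]; [constructor 1|constructor 2].
  by case=> [->|->|abx]; [left|right|case: nc; exists x].
right; split; last 2 first.
- exact: line_clique.
- move=> C Ccl lC; apply/seteqP; split=> // x Cx.
  have [->|xa] := pselect (x = a); first by constructor 1.
  have [->|xb] := pselect (x = b); first by constructor 2.
  constructor 3; apply: Ccl => //; try exact: nesym.
    by apply: lC; constructor 1.
  by apply: lC; constructor 2.
have [ne _ _] := LM; have [_ ac bc] := ne _ _ _ abc.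
pose t (i : 'I_3) := nth a [:: a; b; c] i.
apply: (@inj_card_ge _ _ _ t) => [[i ip] [j jp] eqt|[i ip]].
  apply: val_inj; move: eqt; rewrite /t /=.
  by case: i j ip jp => [|[|[|]]] // [|[|[|]]] // _ _ /=; move=> // /esym //.
rewrite /t /=; case: i ip => [|[|[|]]] // _ /=; by [constructor 1|constructor 2|constructor 3].
Qed.

Lemma lines_pbd (K : set nat) : (forall k, K k -> (0 < k)%N) ->
  (forall a b, a <> b -> exists2 k, K k & line a b #= `I_k) -> pbd M K 1 (@lines M).
Proof.
move=> Kpos sz; split=> //.
  by move=> l /linesP[a [b [ab ->]]]; apply: sz.
move=> p /card_eq_range[x xi ->].
pose i0 : 'I_2 := ord0; pose i1 : 'I_2 := lift ord0 ord0.
have ab : x i0 <> x i1 by move=> /xi.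
suff -> : [set l | lines l /\ range x `<=` l] = [set line (x i0) (x i1)] by exact: card_set1.
apply/seteqP; split=> l /=; last first.
  move=> ->; split; first by apply/linesP; exists (x i0), (x i1).
  move=> _ [[[|[|//]] ip] _ <-].
    by constructor 1; congr x; apply: val_inj.
  by constructor 2; congr x; apply: val_inj.
move=> [/linesP[a [b [nab ->]]] sub]; apply/esym/line_eq => //.
  by apply: sub; exists i0.
by apply: sub; exists i1.
Qed.

End Lines.

(** * Ultrapowers indexed by the natural numbers *)

Section Ultrapower.
Local Open Scope classical_set_scope.
Local Open Scope card_scope.
Variables (M : structure) (U : set_system nat).
Hypothesis UU : UltraFilter U.

(** The class of f modulo U is kept as a set of sequences, so that equality of classes is equality
    of sets; [rep] later chooses a representative. *)
Definition germ (f : nat -> M) : set (nat -> M) := [set g | U [set n | f n = g n]].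

Lemma germP f g : germ f = germ g <-> U [set n | f n = g n].
Proof.
split=> [eqfg|Ufg].
  have : germ g g by apply: (filterS _ filterT).
  by rewrite -eqfg.
apply/seteqP; split=> k Uk; apply: filterS2 Ufg Uk => n /=; first by move=> <-.
by move=> ->.
Qed.

Definition germs : Type := range germ.

Lemma rep_ex (C : germs) : exists f, germ f = val C.
Proof. by have [f _ fC] := set_valP C; exists f. Qed.

Definition rep (C : germs) : nat -> M := projT1 (cid (rep_ex C)).

Lemma repK C : germ (rep C) = val C. Proof. exact: (projT2 (cid (rep_ex C))). Qed.

Definition class (f : nat -> M) : germs := SigSub (mem_set (imageT germ f)).

Lemma rep_class f : U [set n | rep (class f) n = f n].
Proof. by apply/germP; rewrite repK. Qed.

Lemma germs_eq (C D : germs) : C = D <-> U [set n | rep C n = rep D n].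
Proof.
by rewrite -germP !repK; split=> [->//|/val_inj].
Qed.

Definition ultrapower : structure :=
  @Structure germs (fun x y z => U [set n | coll (rep x n) (rep y n) (rep z n)]).

Lemma los n (f : formula n) (v : 'I_n -> ultrapower) :
  sat f v <-> U [set k | sat f (fun i => rep (v i) k)].
Proof.
elim: f v => {n} [n i j|n i j k|n g IH|n g IHg h IHh|n g IH] v //=.
- exact: germs_eq.
- rewrite IH; split=> [nU|Un Ug]; last by have [k []] := filter_ex (filterI Un Ug).
  by case: (in_ultra_setVsetC [set k | sat g (fun i => rep (v i) k)] UU).
- rewrite IHg IHh; split=> [[Ug Uh]|Ugh]; first exact: filterI.
  by split; apply: filterS Ugh => k [].
have sE a k : (fun i => rep (scons a v i) k) = scons (rep a k) (fun i => rep (v i) k).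
  by apply: funext => i; rewrite /scons; case: unlift.
split=> [[a]|Ug].
  by rewrite IH; apply: filterS => k /=; rewrite sE; exists (rep a k).
have /choice[w wP] : forall k, exists a, (exists a, sat g (scons a (fun i => rep (v i) k))) ->
    sat g (scons a (fun i => rep (v i) k)).
  move=> k; case: (pselect (exists a, sat g (scons a (fun i => rep (v i) k)))) => [[a Sa]|no].
    by exists a.
  (* At an index without witness any point will do; M has one because a set in U is inhabited. *)
  have [k0 [a _]] := filter_ex Ug; by exists a => /no.
exists (class w); rewrite IH; apply: filterS (filterI Ug (rep_class w)) => k [/wP Sw eqw] /=.
by rewrite sE eqw.
Qed.

Lemma ultrapower_elementary : elementary (fun m : M => class (fun=> m) : ultrapower).
Proof.
move=> n f v; rewrite los.
have Uv : U [set k | (fun i => rep (class (fun=> v i)) k) = v].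
  have := @filter_forall _ _ (fun i => [set k | rep (class (fun=> v i)) k = v i]) U _.
  move=> /(_ _ (fun i => rep_class _)); apply: filterS => k H; apply: funext => i; exact: H.
split=> [Sv|US]; first by apply: filterS Uv => k /= ->.
by have [k [/= ->]] := filter_ex (filterI Uv US).
Qed.

End Ultrapower.

(** * Uniformly bounded lines in the strongly minimal case *)

Section BlockSizes.
Local Open Scope classical_set_scope.
Local Open Scope card_scope.
Variable M : structure.
Hypotheses (LM : linear_space M) (SM : strongly_minimal M) (NM : no_cofinite_line M).

Let on_line : formula 3 := FRel (lift ord0 ord0) (lift ord0 (lift ord0 ord0)) ord0.

Let pair (T : Type) (a b : T) : 'I_2 -> T := fun i => if i == ord0 then a else b.

Lemma sat_on_line (N : structure) (a b x : N) :
  sat (M := N) on_line (scons x (pair a b)) <-> coll a b x.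
Proof. by rewrite /= /scons !liftK unlift_none. Qed.

(** M is an elementary extension of itself, and cofinitely many points collinear with a and b would
    make their line cofinite. *)
Lemma coll_finite (a b : M) : a <> b -> finite_set [set x | coll a b x].
Proof.
move=> ab; have [_ min] := SM.
have el : elementary (id : M -> M) by [].
have def : definable [set x | coll a b x].
  by exists 2, on_line, (pair a b); apply/seteqP; split=> x /= /sat_on_line.
case: (min M id el _ def) => // cof.
case: (NM (l := line a b)); first by apply/(linesP LM); exists a, b.
by apply: sub_finite_set cof => x /= nx cx; apply: nx; constructor 3.
Qed.

Lemma many_off (a b : M) c : a <> b ->
  exists2 x : 'I_c -> M, injective x & forall i, ~ coll a b (x i).
Proof.
move=> ab; apply: (@card_ge_inj _ _ (~` [set x | coll a b x])).
have [inf _] := SM; have : infinite_set (~` [set x | coll a b x]).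
  move=> fin; apply: inf; rewrite -(setvU [set x | coll a b x]).
  by rewrite finite_setU; split=> //; exact: coll_finite.
move=> /infiniteP; apply: card_le_trans; exact: subset_card_le.
Qed.

Lemma coll_bounded : exists c, forall a b : M, a <> b ->
  ~ exists2 x : 'I_c -> M, injective x & forall i, coll a b (x i).
Proof.
apply: contrapT => nbd.
have /choice[ab abP] : forall c, exists ab : M * M, ab.1 <> ab.2 /\
    exists2 x : 'I_c -> M, injective x & forall i, coll ab.1 ab.2 (x i).
  move=> c; apply: contrapT => nc; apply: nbd; exists c => a b ab Hx.
  by apply: nc; exists (a, b).
(* U contains all final segments, so a property of the n-th pair that holds for all n >= c passes to
   the class of the pairs. By Łoś, this class has at least c points on its line and at least c off
   it, for every c. *)
have [U [UU Uoo]] := ultraFilterLemma eventually_filter.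
have [_ min] := SM.
pose C f : ultrapower M U := class U f.
pose p := pair (C (fun n => (ab n).1)) (C (fun n => (ab n).2)).
pose D := [set x | sat on_line (scons x p)].
have Uab : U [set n | (fun i => rep (p i) n) = pair (ab n).1 (ab n).2].
  apply: filterS (filterI (rep_class UU (fun n => (ab n).1)) (rep_class UU (fun n => (ab n).2))).
  move=> n [/= e1 e2]; apply: funext => i; rewrite /p /pair; by case: ifP.
have Uc c : U [set n | (c <= n)%N] by apply: Uoo; exists c.
have big c : sat (at_least c on_line) p.
  apply/los; apply: filterS (filterI Uab (Uc c)) => n [/= -> cn].
  apply/sat_at_least; have [_ [x xi xc]] := abP n.
  exists (x \o widen_ord cn) => [i j /xi /(congr1 val) /= eqv|i]; first exact: val_inj.
  by apply/sat_on_line; exact: xc.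
have cobig c : sat (at_least c (FNot on_line)) p.
  apply/los; apply: filterS Uab => n /= ->.
  apply/sat_at_least; have [nab _] := abP n; have [x xi xc] := many_off c nab.
  by exists x => // i /sat_on_line; exact: xc.
have def : definable D by exists 2, on_line, p.
have [/finite_setP[c Dc]|/finite_setP[c Dc]] := min _ _ (ultrapower_elementary UU) D def.
- have /sat_at_least[x xi xD] := big c.+1; exact: (finite_few Dc xi xD).
- have /sat_at_least[x xi xD] := cobig c.+1; exact: (finite_few Dc xi xD).
Qed.

Lemma strongly_minimal_pbd : exists (V : Type) (K : set nat),
  finite_set K /\ pbd V K 1 (@lines M).
Proof.
have [c cP] := coll_bounded.
(* Fewer than c points are collinear with a and b, and the line adds a and b themselves. *)
exists M, [set k | (0 < k < c.+2)%N]; split.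
  by apply: sub_finite_set (finite_II c.+2) => k /= /andP[].
apply: lines_pbd => // [k /= /andP[]//|a b ab].
have lineE : line a b = [set a; b] `|` [set x | coll a b x].
  apply/seteqP; split=> x.
    by case=> [->|->|abx]; [left; left|left; right|right].
  by case=> [[->|->]|abx]; [constructor 1|constructor 2|constructor 3].
have : finite_set (line a b).
  by rewrite lineE finite_setU; split; [exact: finite_set2 | exact: coll_finite].
move=> /finite_setP[k lk]; exists k => //=.
have [x xi xE] := card_eq_range lk.
have [ia _ xa] : range x a by rewrite -xE; constructor 1.
have [ib _ xb] : range x b by rewrite -xE; constructor 2.
rewrite (leq_ltn_trans (leq0n ia) (ltn_ord ia)) ltnS leqNgt; apply/negP => ck.
pose J := [set i | `[< coll a b (x i) >]]%SET.
have Jc : #|~: J| <= 2.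
  apply: leq_trans (_ : #|[set ia; ib]%SET| <= 2); last by rewrite cards2; case: (_ != _).
  apply/subset_leq_card/fintype.subsetP => i; rewrite !inE => /asboolPn nc.
  have : line a b (x i) by rewrite xE; exists i.
  by case=> [xia|xib|//]; apply/orP; [left|right]; apply/eqP/xi; rewrite ?xa ?xb.
have cJ : c <= #|J| by have := cardsC J; rewrite card_ord; lia.
apply: (cP a b ab); exists (fun i : 'I_c => x (enum_val (widen_ord cJ i))).
  by move=> i j /xi /enum_val_inj /(congr1 val) /= eqv; apply: val_inj.
by move=> i; have := enum_valP (widen_ord cJ i); rewrite inE => /asboolP.
Qed.

End BlockSizes.

Local Open Scope fset_scope.
Local Open Scope nat_scope.

(** * Finite hypergraphs and 0-primitive extensions *)

(** Set-theoretic facts are checked at one arbitrary element x: hypotheses are specialised to x and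
    memberships become booleans. Negated hypotheses are existential, of no use at a given x, and are
    dropped. *)
Ltac fset_hyps x :=
  repeat match goal with
  | H : is_true (_ `<=` _) |- _ => move/fsubsetP/(_ x): H => H
  | H : is_true (fdisjoint _ _) |- _ => move/fdisjointP/(_ x): H => H
  | H : is_true (~~ _) |- _ => clear H
  | H : _ = _ :> {fset _} |- _ => move/fsetP/(_ x): H => H
  end.

Ltac fset_goal :=
  match goal with
  | |- is_true (_ `<=` _) => apply/fsubsetP
  | |- is_true (fdisjoint _ _) => apply/fdisjointP
  | |- _ = _ :> {fset _} => apply/fsetP
  end.

Ltac bool_close :=
  intros;
  repeat match goal with
  | H : is_true true -> _ |- _ => specialize (H isT)
  | H : is_true false |- _ => discriminate H
  end; solve [done | intuition congruence].

Ltac mem_cases x :=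
  repeat match goal with
  | H : context [x \in ?A] |- _ => move: H
  end;
  rewrite ?inE;
  repeat match goal with
  | |- context [x \in ?A] => case: (x \in A)
  end; rewrite /= ?andbT ?andbF ?orbT ?orbF ?implybT //=; try bool_close.

Ltac fset_tac :=
  let x := fresh "x" in fset_goal; intro x; fset_hyps x; mem_cases x.

Lemma meetP (T : choiceType) (A B : {fset T}) :
  reflect (exists2 x, x \in A & x \in B) (~~ (fdisjoint A B)).
Proof.
apply: (iffP idP) => [|[x xA xB]].
  by rewrite -fsetI_eq0 => /fset0Pn [x]; rewrite inE => /andP[xA xB]; exists x.
by rewrite -fsetI_eq0; apply/fset0Pn; exists x; rewrite inE xA.
Qed.

Lemma cardfs_gt1P (T : choiceType) (A : {fset T}) :
  reflect (exists a b, [/\ a != b, a \in A & b \in A]) (1 < #|` A|).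
Proof.
apply: (iffP idP) => [lt|[a [b [ab aA bA]]]].
  have /fset0Pn[a aA] : A != fset0 by rewrite -cardfs_gt0 ltnW.
  have /fset0Pn[b] : A `\ a != fset0.
    by rewrite -cardfs_gt0; have := cardfsD1 a A; rewrite aA; lia.
  by rewrite !inE => /andP[ba bA]; exists a, b; rewrite eq_sym.
have <- : #|` [fset a; b]| = 2 by rewrite cardfs2 ab.
by apply/fsubset_leq_card/fsubsetP=> x; rewrite !inE => /orP[]/eqP->.
Qed.

Section Images.
Variables (T T' : choiceType) (h : T -> T') (S : {fset T}).
Hypothesis h_inj : {in S &, injective h}.

Lemma mem_imfset_in x (A : {fset T}) :
  x \in S -> A `<=` S -> (h x \in h @` A) = (x \in A).
Proof.
move=> xS /fsubsetP AS; apply/imfsetP/idP => [[y /= yA /h_inj ->]|xA] //; first exact: AS.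
by exists x.
Qed.

Lemma imfset_sub_in (A B : {fset T}) :
  A `<=` S -> B `<=` S -> (h @` A `<=` h @` B) = (A `<=` B).
Proof.
move=> AS BS; apply/fsubsetP/fsubsetP => AB x.
  by move=> xA; rewrite -(mem_imfset_in _ BS) ?AB ?in_imfset // (fsubsetP AS).
by move=> /imfsetP[y /= yA ->]; rewrite in_imfset //= AB.
Qed.

Lemma imfset_inj_in (A B : {fset T}) :
  A `<=` S -> B `<=` S -> h @` A = h @` B -> A = B.
Proof.
move=> AS BS eqAB; apply/eqP; rewrite eqEfsubset -(imfset_sub_in AS BS) -(imfset_sub_in BS AS).
by rewrite eqAB fsubset_refl.
Qed.

Lemma imfset_disj_in (A B : {fset T}) :
  A `<=` S -> B `<=` S -> fdisjoint (h @` A) (h @` B) = fdisjoint A B.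
Proof.
move=> AS BS; apply: negb_inj; apply/meetP/meetP => [[y]|[x xA xB]].
  move=> /imfsetP[x /= xA ->]; rewrite mem_imfset_in // => [xB|]; first by exists x.
  exact: (fsubsetP AS).
by exists (h x); rewrite in_imfset.
Qed.

Lemma card_imfset_in (A : {fset T}) : A `<=` S -> #|` h @` A| = #|` A|.
Proof.
move=> /fsubsetP AS; rewrite card_in_imfset // => x y xA yA; apply: h_inj; exact: AS.
Qed.

Lemma imfset_preim (B : {fset T'}) (A : {fset T}) :
  B `<=` h @` A -> B = h @` [fset x in A | h x \in B].
Proof.
move=> /fsubsetP BA; apply/fsetP=> y; apply/idP/imfsetP => [yB|[x /= ]].
  by have /imfsetP[x /= xA eqy] := BA _ yB; exists x => //; rewrite !inE xA -eqy.
by rewrite !inE => /andP[_ hx] ->.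
Qed.

Lemma imfsetS (A B : {fset T}) : A `<=` B -> h @` A `<=` h @` B.
Proof.
by move=> /fsubsetP AB; apply/fsubsetP=> _ /imfsetP[x /= xA ->]; rewrite in_imfset //= AB.
Qed.

End Images.

Lemma imfset_linv (S : {fset nat}) (h : nat -> nat) : {in S &, injective h} ->
  exists g, {in S, cancel h g}.
Proof.
move=> h_inj; exists (fun y => nth 0 S (find (fun x => h x == y) S)) => x xS.
have hasx : has (fun z => h z == h x) S by apply/hasP; exists x.
apply: h_inj => //; first by rewrite mem_nth // -has_find.
exact/eqP/(nth_find 0 hasx).
Qed.

Lemma imfset_lcan (T T' : choiceType) (S A : {fset T}) (h : T -> T') g : {in S, cancel h g} ->
  A `<=` S -> g @` (h @` A) = A.
Proof.
move=> hK /fsubsetP AS; apply/fsetP => x; apply/imfsetP/idP => /=.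
  by move=> [_ /imfsetP[y /= yA ->] ->]; rewrite hK // AS.
by move=> xA; exists (h x); rewrite ?in_imfset // hK // AS.
Qed.

Section Hypergraph.
Variable w : nat.
Implicit Types (E : {fset nat} -> bool) (A B F X Y Z S e : {fset nat}).
Implicit Types (G : nat -> {fset nat}) (h : nat -> nat).

(* The dimension of X over A is #|X| - w * #|newE E A X|.  Thus [prim] says that
   X is a 0-primitive extension of A, [based] that A is its base, and [str E m]
   that A is self-sufficient as far as m new points can tell. *)
Definition newE E A X : {fset {fset nat}} :=
  [fset e in fpowerset (A `|` X) | E e && ~~ (fdisjoint e X)].

Lemma in_newE E A X e :
  (e \in newE E A X) = [&& e `<=` A `|` X, E e & ~~ (fdisjoint e X)].
Proof. by rewrite !inE /= fpowersetE. Qed.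

Definition prim E A X := [/\ (fdisjoint A X), X != fset0,
  #|` X| = w * #|` newE E A X| &
  forall Y, Y `<=` X -> Y != fset0 -> Y != X -> w * #|` newE E A Y| < #|` Y|].

Definition based E A X := forall a, a \in A -> exists2 e, e \in newE E A X & a \in e.

Definition iso E E' h S := {in S &, injective h} /\
  forall e, e `<=` S -> E e = E' (h @` e).

Definition copies E F G r :=
  [/\ forall i, i < r -> prim E F (G i),
      forall i, i < r -> based E F (G i),
      forall i j, i < r -> j < r -> i <> j -> (fdisjoint (G i) (G j)) &
      forall i j, i < r -> j < r -> exists2 h, iso E E h (F `|` G i) &
        {in F, forall x, h x = x} /\ h @` G i = G j].

Definition str E m A := forall Z, (fdisjoint A Z) -> #|` Z| <= m ->
  w * #|` newE E A Z| <= #|` Z|.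

Lemma iso_sub E E' h S S' : iso E E' h S -> S' `<=` S -> iso E E' h S'.
Proof.
move=> [hi hE] sub; split.
  by move=> x y /(fsubsetP sub) xS /(fsubsetP sub) yS; apply: hi.
by move=> e eS; apply: hE; apply: fsubset_trans sub.
Qed.

Lemma iso_comp E E' E'' h g S : iso E E' h S -> iso E' E'' g (h @` S) ->
  iso E E'' (g \o h) S.
Proof.
move=> [hi hE] [gi gE]; split.
  by move=> x y xS yS /= /gi; rewrite !in_imfset // => /(_ isT isT); apply: hi.
move=> e eS; rewrite hE // gE; last exact: imfsetS.
by rewrite -(imfset_comp _ h g).
Qed.

Lemma iso_inv E E' h g S : iso E E' h S -> {in S, cancel h g} -> iso E' E g (h @` S).
Proof.
move=> [hi hE] hK; split.
  by move=> _ _ /imfsetP[x /= xS ->] /imfsetP[y /= yS ->]; rewrite !hK // => ->.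
move=> e /imfset_preim ->; set e' := [fset x in S | _].
have eS : e' `<=` S by apply/fsubsetP=> x; rewrite !inE => /andP[].
by rewrite (imfset_lcan hK) // hE.
Qed.

Lemma iso_newE E E' h S A X : iso E E' h S -> A `|` X `<=` S ->
  newE E' (h @` A) (h @` X) = (fun e => h @` e) @` newE E A X.
Proof.
move=> [hi hE] AXS; have XS : X `<=` S by fset_tac.
apply/fsetP=> e'; rewrite in_newE; apply/and3P/imfsetP => /= [[]|[e]].
  rewrite -imfsetU => /imfset_preim ->; set e := [fset x in _ | _].
  have eAX : e `<=` A `|` X by apply/fsubsetP=> x; rewrite !inE => /andP[].
  have eS : e `<=` S by apply: fsubset_trans AXS.
  rewrite -hE // (imfset_disj_in hi) // => Ee eX; exists e => //.
  by rewrite in_newE eAX Ee.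
rewrite in_newE => /and3P[eAX Ee eX] ->.
have eS : e `<=` S by apply: fsubset_trans AXS.
by rewrite -imfsetU imfsetS // -hE // (imfset_disj_in hi).
Qed.

Lemma iso_card_newE E E' h S A X : iso E E' h S -> A `|` X `<=` S ->
  #|` newE E' (h @` A) (h @` X)| = #|` newE E A X|.
Proof.
move=> hiso AXS; rewrite (iso_newE hiso AXS) card_in_imfset //= => e1 e2.
rewrite !in_newE => /and3P[e1S _ _] /and3P[e2S _ _] eq12.
by apply: (imfset_inj_in hiso.1) eq12; apply: fsubset_trans AXS.
Qed.

Lemma prim_iso E E' h S A X : iso E E' h S -> A `|` X `<=` S ->
  prim E A X -> prim E' (h @` A) (h @` X).
Proof.
move=> hiso AXS [dAX X0 cX small]; have hi := hiso.1.
have AS : A `<=` S by fset_tac.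
have XS : X `<=` S by fset_tac.
split; first by rewrite (imfset_disj_in hi).
- by rewrite -cardfs_gt0 (card_imfset_in hi) // cardfs_gt0.
- by rewrite (iso_card_newE hiso) // (card_imfset_in hi).
move=> Y' /imfset_preim ->; set Y := [fset x in X | _] => Y0 YX.
have sYX : Y `<=` X by apply/fsubsetP=> x; rewrite !inE => /andP[].
rewrite (iso_card_newE hiso) ?(card_imfset_in hi); try by fset_tac.
apply: small => //; last by apply: contraNneq YX => ->.
by apply: contraNneq Y0 => ->; rewrite imfset0.
Qed.

Lemma based_iso E E' h S A X : iso E E' h S -> A `|` X `<=` S ->
  based E A X -> based E' (h @` A) (h @` X).
Proof.
move=> hiso AXS b _ /imfsetP[x /= xA ->]; have [e eN xe] := b x xA.
exists (h @` e); last by rewrite in_imfset.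
by rewrite (iso_newE hiso) //; apply/imfsetP; exists e.
Qed.

Lemma copies_iso E E' h S F G r : iso E E' h S -> F `<=` S ->
  (forall i, i < r -> G i `<=` S) -> copies E F G r ->
  copies E' (h @` F) (fun i => h @` G i) r.
Proof.
move=> hiso FS GS [pr ba di ii]; have hi := hiso.1.
have US i : i < r -> F `|` G i `<=` S by move=> /GS ?; fset_tac.
split=> [i ir|i ir|i j ir jr ij|i j ir jr].
- exact: (prim_iso hiso (US _ ir) (pr _ ir)).
- exact: (based_iso hiso (US _ ir) (ba _ ir)).
- by rewrite (imfset_disj_in hi) ?GS // di.
have [s [si sE] [sF sG]] := ii i j ir jr.
have [g hK] := imfset_linv hi.
have im : s @` (F `|` G i) = F `|` G j.
  rewrite imfsetU sG; congr (_ `|` _); apply/fsetP=> x.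
  apply/imfsetP/idP => [[y /= yF ->]|xF]; first by rewrite sF.
  by exists x; rewrite //= sF.
exists (h \o (s \o g)).
  rewrite -imfsetU; apply: iso_comp.
    apply: iso_comp; first exact: (iso_inv (iso_sub hiso (US _ ir)) (sub_in1 (fsubsetP (US _ ir)) hK)).
    rewrite (imfset_lcan hK) ?US //; split; first exact: si.
    exact: sE.
  rewrite (imfset_comp _ g s) (imfset_lcan hK) ?US // im.
  exact: iso_sub hiso (US _ jr).
split; first by move=> _ /imfsetP[x /= xF ->]; rewrite /= hK ?sF //; apply: (fsubsetP FS).
by rewrite (imfset_comp _ (s \o g) h) (imfset_comp _ g s) (imfset_lcan hK) ?GS // sG.
Qed.

Lemma newE_sub E E' A A' X X' : (forall e, E e -> E' e) ->
  A `<=` A' `|` X' -> X `<=` X' -> newE E A X `<=` newE E' A' X'.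
Proof.
move=> EE AA XX; apply/fsubsetP=> e; rewrite !in_newE => /and3P[eAX Ee /meetP[x xe xX]].
rewrite EE //=; apply/andP; split; first by fset_tac.
by apply/meetP; exists x => //; apply: (fsubsetP XX).
Qed.

(** The chain rule for the dimension: a block is charged to the last of the two stages that it
    meets. *)
Lemma newE_split E A X1 X2 : (fdisjoint (A `|` X1) X2) ->
  newE E A (X1 `|` X2) = newE E A X1 `|` newE E (A `|` X1) X2.
Proof.
move=> dis; apply/fsetP=> e; rewrite in_fsetU !in_newE.
case Ee : (E e) => /=; last by rewrite !andbF.
rewrite -!fsetUA; case: (boolP (e `<=` A `|` (X1 `|` X2))) => es /=; last first.
  rewrite orbF; symmetry; apply: negbTE; move: es; apply: contra => /andP[eA1 _]; fset_tac.
case: (boolP (fdisjoint e X2)) => d2 /=; rewrite ?orbT ?orbF.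
  have -> : e `<=` A `|` X1 by fset_tac.
  congr (~~ _); apply/idP/idP => H; fset_tac.
apply/meetP; case/meetP: d2 => x xe x2; exists x => //; rewrite inE x2 orbT //.
Qed.

Lemma newE_disj E A X1 X2 : (fdisjoint (A `|` X1) X2) ->
  (fdisjoint (newE E A X1) (newE E (A `|` X1) X2)).
Proof.
move=> dis; apply/fdisjointP=> e; rewrite !in_newE => /and3P[es _ _].
apply/negP => /and3P[_ _ /meetP[x xe x2]].
move/fsubsetP/(_ x xe): es; move/fdisjointP/(_ x): dis; rewrite !inE => H1 H2.
by move: (H1 H2); rewrite x2.
Qed.

Lemma card_newE_split E A X1 X2 : (fdisjoint (A `|` X1) X2) ->
  #|` newE E A (X1 `|` X2)| = #|` newE E A X1| + #|` newE E (A `|` X1) X2|.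
Proof.
move=> dis; rewrite newE_split // -cardfsUI disjoint_fsetI0 ?cardfs0 ?addn0 //.
exact: newE_disj.
Qed.

Lemma card_disj (T : choiceType) (A B : {fset T}) : (fdisjoint A B) ->
  #|` A `|` B| = #|` A| + #|` B|.
Proof. by move=> d; rewrite -cardfsUI disjoint_fsetI0 ?cardfs0 ?addn0. Qed.

(* A proper part of a 0-primitive extension has positive dimension, so what
   remains has negative dimension over it. *)
Lemma prim_rest E A X Y Z : prim E A X -> Y `|` Z = X -> (fdisjoint Y Z) ->
  Y != fset0 -> Z != fset0 -> #|` Z| < w * #|` newE E (A `|` Y) Z|.
Proof.
move=> [AX _ cX small] YZ dYZ Y0 Z0.
have dis : (fdisjoint (A `|` Y) Z) by subst X; fset_tac.
have YX : Y != X.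
  apply: contraNneq Z0 => YX; rewrite -fsubset0; apply/fsubsetP=> x xZ.
  have : x \in Y by rewrite YX -YZ inE xZ orbT.
  by move/(fdisjointP dYZ); rewrite xZ.
have lt : w * #|` newE E A Y| < #|` Y| by apply: small => //; rewrite -YZ fsubsetUl.
have := card_newE_split E dis; rewrite YZ => cs.
have := card_disj dYZ; rewrite YZ => cd.
move: cX; rewrite cs mulnDr; lia.
Qed.

Lemma prim_sub E A X Y : prim E A X -> Y `<=` X -> w * #|` newE E A Y| <= #|` Y|.
Proof.
move=> [_ _ cX small] YX.
have [->|Y0] := eqVneq Y fset0.
  rewrite cardfs0 leqn0 muln_eq0 cardfs_eq0; apply/orP; right.
  apply/eqP/fsetP=> e; rewrite in_newE in_fset0.
  by apply/negbTE/negP => /and3P[_ _ /meetP[x]].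
have [->|Yn] := eqVneq Y X; first by rewrite cX.
exact/ltnW/small.
Qed.

End Hypergraph.

(** * How many copies can meet a 0-primitive extension *)

Section Trichotomy.
Variable w : nat.
Implicit Types (E : {fset nat} -> bool) (A B F X Y Z S e : {fset nat}).
Implicit Types (G : nat -> {fset nat}) (h : nat -> nat).

(** The arithmetic that ends the submodularity arguments: a set of negative dimension cannot have
    all its blocks counted where the dimension is nonnegative. *)
Lemma lt_mul_absurd (a b c d : nat) : a < b * c -> c <= d -> b * d <= a -> false.
Proof. nia. Qed.

Lemma copies_card E F G r i j : copies w E F G r -> i < r -> j < r ->
  #|` G i| = #|` G j|.
Proof.
move=> [_ _ _ ii] ir jr; have [s [si _] [_ <-]] := ii i j ir jr.
by rewrite (card_imfset_in si) // fsubsetUr.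
Qed.

(** By [prim_rest], what g has inside X is of negative dimension over F and the rest of g; the
    blocks responsible are new in g and meet X. *)
Lemma crossing E F g X : prim w E F g -> ~~ (g `<=` X) -> ~~ fdisjoint g X ->
  #|` g `&` X| < w * #|` [fset e in newE E F g | ~~ fdisjoint e X]|.
Proof.
move=> pr gX gmX.
have Y0 : g `\` X != fset0 by rewrite fsetD_eq0.
have Z0 : g `&` X != fset0 by rewrite fsetI_eq0.
have YZ : (g `\` X) `|` (g `&` X) = g by rewrite fsetUC fsetID.
have dYZ : fdisjoint (g `\` X) (g `&` X) by fset_tac.
apply: leq_trans (prim_rest pr YZ dYZ Y0 Z0) _.
rewrite leq_mul2l; apply/orP; right; apply: fsubset_leq_card.
apply/fsubsetP=> e; rewrite in_newE => /and3P[es Ee /meetP[x xe xZ]].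
move: xZ; rewrite inE => /andP[xg xX].
rewrite !inE /= fpowersetE Ee; apply/andP; split; last by apply/meetP; exists x.
apply/andP; split; last by apply/meetP; exists x.
by fset_tac.
Qed.

(* If F meets X, then every copy not contained in X has negative dimension over
   the rest of F, and the dimension of F pays for at most #|F| of them. *)
Lemma copies_trichotomy E A X F G r : 0 < w ->
  (forall e, E e -> ~~ fdisjoint e X -> e `<=` A `|` X) ->
  prim w E A X ->
  (forall Z, fdisjoint (A `|` X) Z -> #|` Z| <= #|` X| ->
     w * #|` newE E A Z| <= #|` Z|) ->
  copies w E F G r -> #|` F| < r ->
  [\/ fdisjoint F X /\ forall i, i < r -> fdisjoint (G i) X,
      F `<=` A /\ exists2 i, i < r & G i = X |
      exists f, [/\ f \in F, f \in X, F `<=` A `|` X &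
        forall i, i < r -> G i `<=` A `|` X]].
Proof.
move=> w_gt0 EX prX strA cop Fr; have [pr ba di ii] := cop.
have [dAX X0 cX small] := prX.
case: (boolP (fdisjoint F X)) => [dFX|/meetP[f fF fX]].
  case: (pselect (forall i, i < r -> fdisjoint (G i) X)) => [?|]; first by constructor 1.
  move=> /existsNP[i] /not_implyP[ir] /negP giX; constructor 2.
  (* As F avoids X, a block of [G i] that meets X does so inside [G i], hence is already counted by
     the intersection over A. With [crossing] this forces [G i] into X, and primitivity of X then
     gives equality. *)
  have sub : [fset e in newE E F (G i) | ~~ fdisjoint e X] `<=` newE E A (G i `&` X).
    apply/fsubsetP=> e; rewrite !inE /= !fpowersetE.
    move=> /andP[/andP[es /andP[Ee _]] eX]; rewrite Ee.
    have eAX := EX _ Ee eX; apply/andP; split; first by fset_tac.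
    case/meetP: eX => x xe xX; apply/meetP; exists x => //; rewrite inE xX andbT.
    move/fsubsetP/(_ x xe): es; rewrite inE => /orP[xF|//].
    by move/fdisjointP/(_ x xF): dFX; rewrite xX.
  have giX' : G i `<=` X.
    apply: contraT => ngi.
    apply: lt_mul_absurd (crossing (pr _ ir) ngi giX) (fsubset_leq_card sub) _.
    exact: prim_sub prX (fsubsetIr (G i) X).
  have all_meet : [fset e in newE E F (G i) | ~~ fdisjoint e X] = newE E F (G i).
    apply/fsetP=> e; rewrite in_fset /= inE.
    case: (boolP (e \in newE E F (G i))) => //=; rewrite in_newE => /and3P[_ _ /meetP[x xe xg]].
    by apply/meetP; exists x; rewrite ?(fsubsetP giX').
  have GX : G i = X.
    apply/eqP; apply: contraT => neq; have [_ g0 cg _] := pr _ ir.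
    have := small _ giX' g0 neq; move: (fsubset_leq_card sub).
    rewrite all_meet (fsetIidPl giX') cg => le; rewrite ltnNge leq_mul2l le orbT //.
  split; last by exists i.
  apply/fsubsetP=> a aF; have [e eN ae] := ba i ir a aF.
  move: eN; rewrite in_newE GX => /and3P[_ Ee eX].
  move/fsubsetP/(_ a ae): (EX _ Ee eX); rewrite inE => /orP[//|aX].
  by move/fdisjointP/(_ a aF): dFX; rewrite aX.
constructor 3; exists f.
have [i ir giX] : exists2 i, i < r & G i `<=` X.
  case: (pselect (exists2 i, i < r & G i `<=` X)) => // nex; exfalso.
  have ngi i : i < r -> ~~ (G i `<=` X) by move=> ir; apply/negP => ?; apply: nex; exists i.
  (* H collects the part of X in F and in the first s copies, U disjoint batches of blocks. Each
     copy lowers the dimension of H by at least 1. As subsets of X have nonnegative dimension over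
     A, at most as many copies as points of F in X can be treated. *)
  have step s : s <= r -> exists H U,
    [/\ H `<=` X, U `<=` newE E A H, F `&` X `<=` H,
        forall e, e \in U -> exists2 i, i < s & e `<=` F `|` G i &
        #|` H| + s <= #|` F `&` X| + w * #|` U|].
    elim: s => [_|s IH sr].
      exists (F `&` X), fset0; split; rewrite ?fsub0set ?fsubsetIr //.
      by rewrite cardfs0 muln0 addn0.
    have [H [U [HX UH FH Us cHU]]] := IH (ltnW sr).
    pose P := [fset e in newE E F (G s) | ~~ fdisjoint e X].
    have cP : #|` G s `&` X| < w * #|` P|.
      case: (boolP (fdisjoint (G s) X)) => dgX; last exact: crossing (pr _ sr) (ngi _ sr) dgX.
      (* A copy that misses X still has a block through f, and f lies in X. *)
      rewrite disjoint_fsetI0 // cardfs0 muln_gt0 w_gt0 /= cardfs_gt0.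
      have [e eN fe] := ba s sr f fF; apply/fset0Pn; exists e.
      by rewrite in_fset /= inE eN; apply/meetP; exists f.
    have dUP : fdisjoint U P.
      apply/fdisjointP=> e /Us[j js ej]; apply/negP; rewrite in_fset /= inE in_newE.
      case/andP=> /and3P[_ _ /meetP[x xe xg]] _.
      have dj : fdisjoint (G j) (G s) by apply: di => // [|js']; [apply: ltn_trans js sr | rewrite js' ltnn in js].
      move/fsubsetP/(_ x xe): ej; rewrite inE => /orP[xF|xj].
        have [dFg _ _ _] := pr s sr; by move/fdisjointP/(_ x xF): dFg; rewrite xg.
      by move/fdisjointP/(_ x xj): dj; rewrite xg.
    exists (H `|` (G s `&` X)), (U `|` P); split.
    - by fset_tac.
    - rewrite fsubUset; apply/andP; split.
        by apply: fsubset_trans UH _; apply: newE_sub => //; fset_tac.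
      apply/fsubsetP=> e; rewrite !inE /= !fpowersetE.
      move=> /andP[/andP[es /andP[Ee _]] eX]; rewrite Ee.
      have eAX := EX _ Ee eX; apply/andP; split; first by fset_tac.
      case/meetP: eX => x xe xX; apply/meetP; exists x => //.
      move: xX; fset_hyps x; mem_cases x.
    - by fset_tac.
    - move=> e; rewrite inE => /orP[/Us[j js ej]|]; first by exists j => //; apply: leqW.
      by rewrite in_fset /= inE in_newE => /andP[/and3P[es _ _] _]; exists s.
    rewrite (card_disj dUP) mulnDr.
    have : #|` H `|` (G s `&` X)| <= #|` H| + #|` G s `&` X| by rewrite -cardfsUI leq_addr.
    clear -cHU cP; lia.
  have [H [U [HX UH FH _ cHU]]] := step r (leqnn r).
  have le1 := prim_sub prX HX; have leU := fsubset_leq_card UH.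
  have le2 : w * #|` U| <= w * #|` newE E A H| by rewrite leq_mul2l leU orbT.
  have := fsubset_leq_card (fsubsetIl F X); clear -le1 le2 cHU Fr; lia.
have FAX : F `<=` A `|` X.
  apply/fsubsetP=> a aF; have [e eN ae] := ba i ir a aF.
  move: eN; rewrite in_newE => /and3P[_ Ee /meetP[x xe xg]].
  apply: (fsubsetP (EX _ Ee _)) => //.
  by apply/meetP; exists x => //; apply: (fsubsetP giX).
(* The part of [G j] outside A and X would have negative dimension over A. It is within the reach of
   self-sufficiency since all copies have the size of [G i], a subset of X. *)
split=> // j jr; apply: contraT => ngj.
have gm : ~~ fdisjoint (G j) (A `|` X).
  have [e eN fe] := ba j jr f fF.
  move: eN; rewrite in_newE => /and3P[_ Ee /meetP[x xe xg]].
  apply/meetP; exists x => //; apply: (fsubsetP (EX _ Ee _)) => //.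
  by apply/meetP; exists f.
set Z := G j `\` (A `|` X).
have Z0 : Z != fset0 by rewrite fsetD_eq0.
have Y0 : G j `&` (A `|` X) != fset0 by rewrite fsetI_eq0.
have dYZ : fdisjoint (G j `&` (A `|` X)) Z by rewrite /Z; fset_tac.
have := prim_rest (pr _ jr) (fsetID _ _) dYZ Y0 Z0.
have dZ : fdisjoint (A `|` X) Z by rewrite /Z; fset_tac.
have cZ : #|` Z| <= #|` X|.
  apply: leq_trans (fsubset_leq_card giX); rewrite (copies_card cop ir jr).
  by apply: fsubset_leq_card; rewrite fsubsetDl.
have sub : newE E (F `|` (G j `&` (A `|` X))) Z `<=` newE E A Z.
  apply/fsubsetP=> e; rewrite !in_newE => /and3P[es Ee eZ]; rewrite Ee eZ !andbT.
  have dX : fdisjoint e X.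
    apply: contraT => eX; case/meetP: eZ => x xe xZ.
    by move/fsubsetP/(_ x xe): (EX _ Ee eX) => xAX; move/fdisjointP/(_ x xAX): dZ; rewrite xZ.
  by fset_tac.
by move=> lt; have := lt_mul_absurd lt (fsubset_leq_card sub) (strA _ dZ cZ).
Qed.

End Trichotomy.

(** * Amalgamation *)

Section Construction.
Variables (w : nat) (mu : nat -> nat).
Implicit Types (E : {fset nat} -> bool) (A B F X Y Z S e : {fset nat}).
Implicit Types (G : nat -> {fset nat}) (h : nat -> nat).

Definition klass E :=
  [/\ forall e, E e -> #|` e| = w.+2,
      forall e1 e2, E e1 -> E e2 -> 1 < #|` e1 `&` e2| -> e1 = e2,
      forall X, w * #|` newE E fset0 X| <= #|` X| &
      forall F G r, copies w E F G r -> r <= mu #|` F|].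

Definition below N A := forall x, x \in A -> x < N.

(* An extension is added to a structure by listing its new blocks: the label
   [inl a] stands for the old point a, and [inr y] for the fresh point N + y. *)
Definition inst (N : nat) (x : nat + nat) := match x with inl a => a | inr y => N + y end.

Definition glue E N (P : {fset {fset (nat + nat)%type}}) e :=
  E e || (e \in (fun p : {fset (nat + nat)%type} => inst N @` p) @` P).

Definition label A h x : nat + nat := if x \in A then inl (h x) else inr x.

Definition fresh A h N x := if x \in A then h x else N + x.

(** The bound N does not occur here, so that one finite code names the same task at every stage. *)
Definition pattern E A X h : {fset {fset (nat + nat)%type}} :=
  (fun e : {fset nat} => label A h @` e) @` newE E A X.

(** Removing an uncovered point would keep all new blocks and leave a proper part of negative
    dimension. *)
Lemma prim_cover E A X x : prim w E A X -> x \in X ->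
  exists2 e, e \in newE E A X & x \in e.
Proof.
move=> [AX X0 cX small] xX.
case: (pselect (exists2 e, e \in newE E A X & x \in e)) => // nex; exfalso.
have sub : newE E A X `<=` newE E A (X `\ x).
  apply/fsubsetP=> e eN; have xe : x \notin e.
    by apply/negP => xe; apply: nex; exists e.
  move: eN; rewrite !in_newE => /and3P[es -> /meetP[y ye yX]] /=.
  have yx : y != x by apply: contraNneq xe => <-.
  apply/andP; split; last by apply/meetP; exists y; rewrite // !inE yx.
  apply/fsubsetP=> z ze; move: (fsubsetP es z ze); rewrite !inE => /orP[->//|->].
  by rewrite andbT (contraNneq _ xe) ?orbT // => <-.
have := fsubset_leq_card sub.
have cx := cardfsD1 x X; rewrite xX in cx.
have [Y0|Y0] := eqVneq (X `\ x) fset0.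
  have -> : newE E A (X `\ x) = fset0.
    apply/fsetP=> e; rewrite in_newE Y0 in_fset0; apply/negbTE/negP => /and3P[_ _ /meetP[]//].
  by rewrite cardfs0 leqn0 => /eqP c0; rewrite c0 muln0 in cX; lia.
have YX : X `\ x != X by apply/eqP => eqX; move: xX; rewrite -eqX !inE eqxx.
by move=> le; have := small _ (fsubD1set X x) Y0 YX; nia.
Qed.

Lemma newE_sub_id E E' A X S : (forall e, e `<=` S -> E e = E' e) -> A `|` X `<=` S ->
  newE E A X = newE E' A X.
Proof.
move=> EE AXS; apply/fsetP=> e; rewrite !in_newE.
case: (boolP (e `<=` A `|` X)) => //= es; rewrite EE //.
exact: fsubset_trans AXS.
Qed.

Lemma copies_id E E' F G r S : (forall e, e `<=` S -> E e = E' e) -> F `<=` S ->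
  (forall i, i < r -> G i `<=` S) -> copies w E F G r -> copies w E' F G r.
Proof.
move=> EE FS GS cop.
have hiso : iso E E' id S by split=> [//|e eS]; rewrite imfset_id EE.
have := copies_iso hiso FS GS cop; rewrite imfset_id.
by have -> : (fun i => id @` G i) = G by apply: funext => i; rewrite imfset_id.
Qed.

(** * The free amalgam of one 0-primitive extension *)

Section Amalgam.
Variables (E0 E1 : {fset nat} -> bool) (N : nat) (A X : {fset nat}) (h : nat -> nat).
Hypothesis bd0 : forall e, E0 e -> below N e.
Hypothesis prX : prim w E1 A X.
Hypothesis hA : iso E1 E0 h A.
Hypothesis bdA : below N (h @` A).

Let psi := fresh A h N.
Let D := glue E0 N (pattern E1 A X h).

Lemma glueE e : D e = E0 e || (e \in (fun e : {fset nat} => psi @` e) @` newE E1 A X).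
Proof.
rewrite /D /glue /pattern; congr (_ || (_ \in _)).
rewrite -(imfset_comp _ (fun e : {fset nat} => label A h @` e) (fun p : {fset (nat + nat)%type} => inst N @` p)).
apply: eq_in_imfset => a _ /=; rewrite -(imfset_comp _ (label A h) (inst N)).
by apply: eq_in_imfset => x _; rewrite /= /label /psi /fresh; case: ifP.
Qed.

Lemma psiA x : x \in A -> psi x = h x. Proof. by rewrite /psi /fresh => ->. Qed.

Lemma psi_imA : psi @` A = h @` A.
Proof. by apply: eq_in_imfset => x; exact: psiA. Qed.

Lemma psiX x : x \in X -> psi x = N + x.
Proof.
rewrite /psi /fresh; case: ifP => // xA xX.
by have [/fdisjointP/(_ x xA)] := prX; rewrite xX.
Qed.

Lemma psi_inj : {in A `|` X &, injective psi}.
Proof.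
have lt x : x \in A -> psi x < N by move=> xA; rewrite psiA //; apply: bdA; rewrite in_imfset.
move=> x y; rewrite !in_fsetU => /orP[xA|xX] /orP[yA|yX] eqxy.
- by move: eqxy; rewrite !psiA //; apply: hA.1.
- by move: (lt x xA); rewrite eqxy psiX //; lia.
- by move: (lt y yA); rewrite -eqxy psiX //; lia.
- by move: eqxy; rewrite !psiX // => /addnI.
Qed.

Lemma E0_disj e : E0 e -> fdisjoint e (psi @` X).
Proof.
move=> /bd0 be; apply/fdisjointP=> x /be xN; apply/negP => /imfsetP[y /= yX eqx].
by move: xN; rewrite eqx psiX //; lia.
Qed.

Lemma new_meets e : e \in newE E1 A X -> ~~ fdisjoint (psi @` e) (psi @` X).
Proof.
rewrite in_newE => /and3P[_ _ /meetP[x xe xX]].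
by apply/meetP; exists (psi x); rewrite in_imfset.
Qed.

(** Freeness of the amalgam, in the form that [copies_trichotomy] asks for. *)
Lemma D_meets e : D e -> ~~ fdisjoint e (psi @` X) -> e `<=` h @` A `|` psi @` X.
Proof.
rewrite glueE => /orP[/E0_disj -> //|/imfsetP[e' /= ]].
by rewrite in_newE -psi_imA -imfsetU => /and3P[es _ _] -> _; apply: imfsetS.
Qed.

Lemma D_avoids e : fdisjoint e (psi @` X) -> D e = E0 e.
Proof.
rewrite glueE => dX; apply/orP/idP => [[//|/imfsetP[e' /= eN eqe]]|]; last by left.
by move: (new_meets eN); rewrite -eqe dX.
Qed.

Lemma psi_iso : iso E1 D psi (A `|` X).
Proof.
split=> [|e eAX]; first exact: psi_inj.
case: (boolP (fdisjoint e X)) => dX.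
  have eA : e `<=` A by fset_tac.
  have -> : psi @` e = h @` e.
    by apply: eq_in_imfset => x xe; rewrite psiA //; apply: (fsubsetP eA).
  rewrite D_avoids ?hA.2 //.
  apply/fdisjointP=> _ /imfsetP[x /= /(fsubsetP eA) xA ->]; apply/negP => /imfsetP[y /= yX].
  by move=> eqh; move: (bdA (x := h x)); rewrite in_imfset // eqh psiX // => /(_ isT); lia.
rewrite glueE; apply/idP/orP => [Ee|[|/imfsetP[e' /= ]]].
- by right; apply/imfsetP; exists e => //=; rewrite in_newE eAX Ee.
- move=> /E0_disj dE; case/meetP: dX => x xe xX.
  by move/fdisjointP/(_ (psi x)): dE; rewrite !in_imfset // => /(_ isT).
by rewrite in_newE => /and3P[es Ee _] /(imfset_inj_in psi_inj) -> //.
Qed.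

Lemma prim_D : prim w D (h @` A) (psi @` X).
Proof. by rewrite -psi_imA; apply: prim_iso psi_iso _ prX; apply: fsubset_refl. Qed.

Hypothesis K0 : klass E0.
Hypothesis size1 : forall e, e \in newE E1 A X -> #|` e| = w.+2.
Hypothesis lin1 : forall e1 e2, e1 \in newE E1 A X -> e2 \in newE E1 A X ->
  1 < #|` e1 `&` e2| -> e1 = e2.
Hypothesis lin01 : forall e e2, e \in newE E1 A X -> E0 e2 ->
  #|` e2 `&` h @` (e `&` A)| <= 1.
Hypothesis strA : str w E0 #|` X| (h @` A).

(** An old and a new block can share points of the base only, where [lin01] allows at most one. *)
Lemma D_linear e1 e2 : D e1 -> D e2 -> 1 < #|` e1 `&` e2| -> e1 = e2.
Proof.
have [_ lin0 _ _] := K0.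
have mixed e a : E0 e -> a \in newE E1 A X -> #|` e `&` psi @` a| <= 1.
  move=> Ee aN; apply: leq_trans (lin01 aN Ee); apply: fsubset_leq_card.
  have dE := E0_disj Ee.
  apply/fsubsetP=> x; rewrite !inE => /andP[xe /imfsetP[y /= ya eqx]]; rewrite xe /= eqx.
  have yAX : y \in A `|` X by move: aN; rewrite in_newE => /and3P[/fsubsetP/(_ y ya)].
  move: yAX; rewrite inE => /orP[yA|yX]; first by rewrite psiA // in_imfset // inE ya.
  by move/fdisjointP/(_ x xe): dE; rewrite eqx in_imfset.
rewrite !glueE => /orP[E1e|/imfsetP[a1 /= a1N ->]] /orP[E2e|/imfsetP[a2 /= a2N ->]].
- exact: lin0.
- by rewrite ltnNge mixed.
- by rewrite fsetIC ltnNge mixed.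
move=> lt; suff -> : a1 = a2 by []; apply: lin1 => //.
have sub a : a \in newE E1 A X -> a `<=` A `|` X by rewrite in_newE => /andP[].
have im : psi @` a1 `&` psi @` a2 = psi @` (a1 `&` a2).
  apply/fsetP=> x; rewrite inE; apply/andP/imfsetP => [[/imfsetP[y /= y1 ->]]|[y /= y12 ->]].
    rewrite (mem_imfset_in psi_inj) ?sub // => [y2|]; first by exists y; rewrite // inE y1.
    exact: (fsubsetP (sub _ a1N)).
  by move: y12; rewrite inE => /andP[y1 y2]; rewrite !in_imfset.
move: lt; rewrite im (card_imfset_in psi_inj) //.
by apply: fsubset_trans (sub _ a1N); apply: fsubsetIl.
Qed.

(** The points of Z outside the new copy carry old blocks only; those inside it are bounded by
    primitivity, since all blocks through them stay in the base and the copy. *)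
Lemma D_pos Z : w * #|` newE D fset0 Z| <= #|` Z|.
Proof.
have [_ _ pos0 _] := K0.
pose X' := psi @` X.
have eqZ : Z = (Z `\` X') `|` (Z `&` X') by rewrite fsetUC fsetID.
have dis : fdisjoint (fset0 `|` (Z `\` X')) (Z `&` X') by fset_tac.
rewrite {1}eqZ card_newE_split // mulnDr -(cardfsID X' Z) addnC leq_add //.
  apply: leq_trans (prim_sub prim_D (fsubsetIr Z X')); rewrite leq_mul2l; apply/orP; right.
  apply/fsubset_leq_card/fsubsetP=> e; rewrite !in_newE => /and3P[es De dZ].
  have eX : ~~ fdisjoint e X'.
    by case/meetP: dZ => x xe; rewrite inE => /andP[_ xX]; apply/meetP; exists x.
  have := D_meets De eX; rewrite De dZ !andbT -/X' => eAX; fset_tac.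
have -> : newE D fset0 (Z `\` X') = newE E0 fset0 (Z `\` X').
  apply/fsetP=> e; rewrite !in_newE; case: (boolP (e `<=` _)) => //= es.
  by rewrite D_avoids // -/X'; fset_tac.
exact: pos0.
Qed.

Hypothesis w_gt0 : 0 < w.
Hypothesis mu_ge : forall p, p + 2 <= mu p.

(** Only the bound on copies can fail. Of the three cases of the trichotomy the first is excluded:
    copies that avoid the new points are copies in [E0], where the bound holds. *)
Lemma amalgam : klass D \/ exists F G r, [/\ mu #|` F| < r, copies w D F G r &
  (F `<=` h @` A /\ exists2 i, i < r & G i = psi @` X) \/
  (exists f, [/\ f \in F, f \in psi @` X, F `<=` h @` A `|` psi @` X &
     forall i, i < r -> G i `<=` h @` A `|` psi @` X])].
Proof.
case: (pselect (forall F G r, copies w D F G r -> r <= mu #|` F|)) => [bdD|].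
  left; split=> // [e|e1 e2|Z]; [|exact: D_linear|exact: D_pos].
  have [sz0 _ _ _] := K0; rewrite glueE => /orP[/sz0//|/imfsetP[a /= aN ->]].
  rewrite (card_imfset_in psi_inj) ?size1 //.
  by move: aN; rewrite in_newE => /andP[].
move=> /existsNP[F] /existsNP[G] /existsNP[r] /not_implyP[cop] /negP; rewrite -ltnNge => mur.
have XX : #|` psi @` X| = #|` X| by rewrite (card_imfset_in psi_inj) // fsubsetUr.
have Fr : #|` F| < r by have := mu_ge #|` F|; lia.
right; exists F, G, r; split=> //.
have strD Z : fdisjoint (h @` A `|` psi @` X) Z -> #|` Z| <= #|` psi @` X| ->
    w * #|` newE D (h @` A) Z| <= #|` Z|.
  move=> dZ cZ; have -> : newE D (h @` A) Z = newE E0 (h @` A) Z.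
    apply/fsetP=> e; rewrite !in_newE.
    case: (boolP (e `<=` _)) => //= es; case: (boolP (fdisjoint e Z)) => eZ; rewrite ?andbF ?andbT //=.
    case: (boolP (fdisjoint e (psi @` X))) => dX; first by rewrite D_avoids.
    apply/idP/idP => [/D_meets/(_ dX) eAX|/E0_disj]; last by rewrite (negbTE dX).
    by case/meetP: eZ => x xe xZ; move/fdisjointP/(_ x): dZ; rewrite xZ (fsubsetP eAX x xe) => /(_ isT).
  by apply: strA; [fset_tac | rewrite -XX].
case: (copies_trichotomy w_gt0 D_meets prim_D strD cop Fr) => [[FX GX]|H|H]; [|by left|by right].
have [_ _ _ cp0] := K0.
have : copies w E0 F G r; last by move/cp0; lia.
pose S := F `|` (\bigcup_(i <- iota 0 r) G i)%fset.
have dS : fdisjoint S (psi @` X).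
  apply/fdisjointP=> x; rewrite inE => /orP[xF|/bigfcupP[i ir xG]].
    exact: (fdisjointP FX).
  move: ir; rewrite mem_iota /= andbT add0n => ir; exact: (fdisjointP (GX i ir)).
apply: (copies_id (S := S)) cop => [e eS||i ir].
- by rewrite D_avoids //; fset_tac.
- exact: fsubsetUl.
apply: fsubset_trans (fsubsetUr _ _).
by apply: bigfcup_sup; rewrite ?mem_iota.
Qed.

End Amalgam.
End Construction.

(** * The generic structure *)

Section Limit.
Variables (w : nat) (mu : nat -> nat).
Hypothesis w_gt0 : 0 < w.
Hypothesis mu_ge : forall p, p + 2 <= mu p.
Implicit Types (E : {fset nat} -> bool) (A B F X Y Z S e : {fset nat}).
Implicit Types (G : nat -> {fset nat}) (h : nat -> nat).
Implicit Types (P : {fset {fset (nat + nat)%type}}).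

Lemma below_ex S : exists n, below n S.
Proof.
exists (\max_(x <- S) x).+1 => x xS; by rewrite ltnS; apply: (@leq_bigmax_seq _ _ predT id).
Qed.

Lemma glue_bounded E N P : (forall e, E e -> below N e) ->
  exists n, N < n /\ forall e, glue E N P e -> below n e.
Proof.
move=> bE; have [n bn] := below_ex (\bigcup_(p <- P) (inst N @` p))%fset.
exists (n + N).+1; split=> [|e /orP[/bE be x /be|/imfsetP[p /= pP ->] x xp]]; try lia.
have : x < n by apply: bn; apply/bigfcupP; exists p; rewrite ?pP.
lia.
Qed.

(** The second clause gives each added block a fresh point, so that the blocks among points below N
    are settled for good. *)
Definition admissible E N P :=
  klass w mu (glue E N P) /\ forall p, p \in P -> exists y, inr y \in p.

(** By [glue_bounded] a suitable bound exists whenever this is called, so the default value never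
    occurs. *)
Definition next_bound E N : nat := xget N.+1 [set n | N < n /\ forall e, E e -> below n e]%classic.

Definition step (s : ({fset nat} -> bool) * nat) P : ({fset nat} -> bool) * nat :=
  if `[< admissible s.1 s.2 P >]
  then (glue s.1 s.2 P, next_bound (glue s.1 s.2 P) s.2) else (s.1, s.2.+1).

(* The first component of the code makes every task recur infinitely often. *)
Definition task (i : nat) : {fset {fset (nat + nat)%type}} :=
  if (choice.unpickle i : option (nat * {fset {fset (nat + nat)%type}})%type) is Some p then p.2 else fset0.

Fixpoint stage (i : nat) : ({fset nat} -> bool) * nat :=
  if i is j.+1 then step (stage j) (task j) else (fun=> false, 0).

Notation blocks_at i := (stage i).1.
Notation bound_at i := (stage i).2.

Lemma klass_empty : klass w mu (fun=> false).
Proof.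
have new0 A X : newE (fun=> false) A X = fset0.
  by apply/fsetP=> e; rewrite in_newE andbF.
split=> // [X|F G [//|r] [pr _ _ _]]; first by rewrite new0 cardfs0 muln0.
have [_ X0 cX _] := pr 0 isT; move: X0.
by rewrite -cardfs_eq0 cX new0 cardfs0 muln0 eqxx.
Qed.

Lemma stageP i : [/\ klass w mu (blocks_at i), forall e, (blocks_at i) e -> below (bound_at i) e & i <= (bound_at i)].
Proof.
elim: i => [|i [kl bd iN]]; first by split=> //; exact: klass_empty.
rewrite /= /step; case: asboolP => [[kl' _]|_] /=; last first.
  by split=> // e /bd be x /be; lia.
rewrite /next_bound; case: xgetP => [n -> [ltn bn]|no].
  by split=> //; lia.
by have [n nP] := glue_bounded (task i) bd; case: (no n).
Qed.

Lemma stage_step i : [/\ forall e, (blocks_at i) e -> (blocks_at i.+1) e, (bound_at i) < (bound_at i.+1) &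
  forall e, below (bound_at i) e -> (blocks_at i.+1) e -> (blocks_at i) e].
Proof.
have [_ bd _] := stageP i; rewrite /= /step; case: asboolP => [[_ ne]|//] /=.
split=> [e Ee|| e be]; first by rewrite /glue Ee.
  rewrite /next_bound; case: xgetP => [n -> [//]|no].
  by have [n nP] := glue_bounded (task i) bd; case: (no n).
rewrite /glue => /orP[//|/imfsetP[p /= /ne [y yp] eqe]].
by have := be ((bound_at i) + y); rewrite eqe => /(_ (in_imfset _ _ yp)); lia.
Qed.

Lemma stage_le i j : i <= j -> [/\ forall e, (blocks_at i) e -> (blocks_at j) e, (bound_at i) <= (bound_at j) &
  forall e, below (bound_at i) e -> (blocks_at j) e -> (blocks_at i) e].
Proof.
move=> /subnK <-; elim: (j - i) => [|d [EE NN ee]] //; rewrite addSn.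
have [EE' NN' ee'] := stage_step (d + i); split=> [e /EE /EE'|| e be Ee] //.
  exact: leq_trans NN (ltnW NN').
by apply: ee => //; apply: ee' => // x /be; lia.
Qed.

Definition limit e : bool := `[< exists i, (blocks_at i) e >].

Lemma limit_stage i e : (blocks_at i) e -> limit e. Proof. by move=> ?; apply/asboolP; exists i. Qed.

Lemma limit_below i e : below (bound_at i) e -> limit e = (blocks_at i) e.
Proof.
move=> be; apply/asboolP/idP => [[j Ej]|]; last by exists i.
have [ij|/ltnW ji] := leqP i j; first by have [_ _ H] := stage_le ij; exact: H.
by have [H _ _] := stage_le ji; exact: H.
Qed.

Lemma limit_local S : exists i, forall e, e `<=` S -> limit e = (blocks_at i) e.
Proof.
have [n bn] := below_ex S; exists n => e eS; apply: limit_below => x xe.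
by have [_ _ nN] := stageP n; apply: leq_trans nN; apply: bn; apply: (fsubsetP eS).
Qed.

(** Each axiom, the one on r copies included, speaks of finitely many points, where the limit agrees
    with some stage. *)
Lemma klass_limit : klass w mu limit.
Proof.
split=> [e|e1 e2|X|F G r cop].
- by move=> /asboolP[i]; have [[sz _ _ _] _ _] := stageP i; exact: sz.
- have [i Ei] := limit_local (e1 `|` e2); have [[_ lin _ _] _ _] := stageP i.
  by rewrite !Ei ?fsubsetUl ?fsubsetUr //; exact: lin.
- have [i Ei] := limit_local (fset0 `|` X); have [[_ _ pos _] _ _] := stageP i.
  by rewrite (newE_sub_id Ei) ?fsubset_refl.
pose S := F `|` (\bigcup_(i <- iota 0 r) G i)%fset.
have [j Ej] := limit_local S; have [[_ _ _ cp] _ _] := stageP j; apply: (cp _ G).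
apply: (copies_id Ej) cop => [|i ir]; first exact: fsubsetUl.
apply: fsubset_trans (fsubsetUr _ _).
by apply: bigfcup_sup; rewrite ?mem_iota.
Qed.

Lemma task_visit P b : exists2 i, b <= i & task i = P.
Proof.
pose f (j : nat) := choice.pickle (j, P).
have f_inj : injective f by move=> x y /(pcan_inj choice.pickleK) [].
have [j jb] : exists j, b <= f j.
  apply: contrapT => nex.
  have lt j : f j < b by rewrite ltnNge; apply/negP => ?; apply: nex; exists j.
  have : injective (fun j : 'I_b.+1 => Ordinal (lt j)).
    by move=> x y [] /f_inj /val_inj.
  by move=> /leq_card; rewrite !card_ord ltnn.
by exists (f j) => //; rewrite /task /f choice.pickleK.
Qed.

Lemma str_stage i m A : str w limit m A -> str w (blocks_at i) m A.
Proof.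
move=> sA Z dZ cZ; apply: leq_trans (sA Z dZ cZ); rewrite leq_mul2l; apply/orP; right.
by apply/fsubset_leq_card/newE_sub => // [e /limit_stage//|]; exact: fsubsetUl.
Qed.

(** Every task recurs, so it is met at a stage past b: either it is carried out there, or [amalgam]
    explains the refusal. The freedom in b is what lets [max_copies] place successive copies
    disjointly. *)
Lemma visit E1 A X h b : prim w E1 A X -> iso E1 limit h A ->
  (forall e, e \in newE E1 A X -> #|` e| = w.+2) ->
  (forall e1 e2, e1 \in newE E1 A X -> e2 \in newE E1 A X ->
    1 < #|` e1 `&` e2| -> e1 = e2) ->
  (forall e e2, e \in newE E1 A X -> limit e2 -> #|` e2 `&` h @` (e `&` A)| <= 1) ->
  str w limit #|` X| (h @` A) ->
  exists i D psi, [/\ b <= (bound_at i) /\ below (bound_at i) (h @` A), iso E1 D psi (A `|` X),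
    {in A, psi =1 h} /\ (forall x, x \in X -> (bound_at i) <= psi x),
    forall e, fdisjoint e (psi @` X) -> D e = (blocks_at i) e &
    (iso E1 limit psi (A `|` X) /\ exists j, below (bound_at j) (psi @` X)) \/
    exists F G r, [/\ mu #|` F| < r, copies w D F G r &
      (F `<=` h @` A /\ exists2 i, i < r & G i = psi @` X) \/
      (exists f, [/\ f \in F, f \in psi @` X, F `<=` h @` A `|` psi @` X &
         forall i, i < r -> G i `<=` h @` A `|` psi @` X])]].
Proof.
move=> prX hA sz1 lin1 lin01 sA.
have [n bn] := below_ex (h @` A).
have [i iP taskE] := task_visit (pattern E1 A X h) (b + n).
have [kl bd iN] := stageP i.
have bA : below (bound_at i) (h @` A) by move=> x /bn; lia.
have hAi : iso E1 (blocks_at i) h A.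
  split; first exact: hA.1.
  move=> e eA; rewrite hA.2 //; apply: limit_below => x xe; apply: bA.
  exact: (fsubsetP (imfsetS h eA)).
have lin01i e e2 : e \in newE E1 A X -> (blocks_at i) e2 -> #|` e2 `&` h @` (e `&` A)| <= 1.
  by move=> eN /limit_stage; exact: lin01.
have am := amalgam bd prX hAi bA kl sz1 lin1 lin01i (str_stage i sA) w_gt0 mu_ge.
have pi := psi_iso bd prX hAi bA.
exists i, (glue (blocks_at i) (bound_at i) (pattern E1 A X h)), (fresh A h (bound_at i)); split=> //.
- by split=> //; lia.
- split; first exact: psiA.
  by move=> x xX; rewrite (psiX _ h prX xX) leq_addr.
- exact: D_avoids.
case: am => [klD|]; last by right.
left; have adm : admissible (blocks_at i) (bound_at i) (task i).
  split; first by rewrite taskE.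
  rewrite taskE => p /imfsetP[e /= eN ->]; move: (eN).
  rewrite in_newE => /and3P[_ _ /meetP[x xe xX]]; exists x; apply/imfsetP; exists x => //=.
  rewrite /label; case: ifP => // xA; have [/fdisjointP/(_ x xA)] := prX; by rewrite xX.
have Ei1 : (blocks_at i.+1) = glue (blocks_at i) (bound_at i) (pattern E1 A X h).
  by rewrite /= /step; case: asboolP => [_|//] /=; rewrite taskE.
have bX : below (bound_at i.+1) (fresh A h (bound_at i) @` X).
  have [_ bd1 _] := stageP i.+1.
  (* Stage bounds control the points of blocks only; a fresh point is reached because it lies on a
     new block. *)
  move=> _ /imfsetP[x /= xX ->]; have [e eN xe] := prim_cover prX xX.
  apply: (bd1 (fresh A h (bound_at i) @` e)); last by rewrite in_imfset.
  rewrite Ei1 -pi.2; first by move: eN; rewrite in_newE => /and3P[].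
  by move: eN; rewrite in_newE => /and3P[].
split; last by exists i.+1.
split; first exact: pi.1.
move=> e eAX; rewrite pi.2 // -Ei1; symmetry; apply: limit_below => x /(fsubsetP (imfsetS _ eAX)).
rewrite imfsetU inE => /orP[|]; last exact: bX.
have [_ lt _] := stage_step i.
move=> /imfsetP[y /= yA ->]; rewrite (psiA _ _ yA).
by apply: ltn_trans lt; apply: bA; rewrite in_imfset.
Qed.

End Limit.

(** * Extension of partial isomorphisms *)

Section Extension.
Variables (w : nat) (mu : nat -> nat).
Hypothesis w_gt0 : 0 < w.
Hypothesis mu_ge : forall p, p + 2 <= mu p.
Implicit Types (E : {fset nat} -> bool) (A B F X Y Z S e : {fset nat}).
Implicit Types (G : nat -> {fset nat}) (h : nat -> nat).

Notation L := (limit w mu).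

Lemma L_size e : L e -> #|` e| = w.+2.
Proof. by have [sz _ _ _] := klass_limit mu w_gt0; exact: sz. Qed.

Lemma L_linear e1 e2 : L e1 -> L e2 -> 1 < #|` e1 `&` e2| -> e1 = e2.
Proof. by have [_ lin _ _] := klass_limit mu w_gt0; exact: lin. Qed.

(** Each copy has a block through the base point f and a point of that copy; disjointness keeps
    these blocks distinct. *)
Lemma copies_degree E F G r f : copies w E F G r -> f \in F ->
  exists ee, [/\ forall i, i < r -> E (ee i), forall i, i < r -> f \in ee i,
    forall i, i < r -> ee i `<=` F `|` G i &
    forall i j, i < r -> j < r -> i <> j -> ee i <> ee j].
Proof.
move=> [pr ba di _] fF.
have /choice[ee eeP] : forall i, exists e, i < r -> e \in newE E F (G i) /\ f \in e.
  move=> i; case: (ltnP i r) => [ir|]; last by exists fset0.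
  by have [e eN fe] := ba i ir f fF; exists e.
have P i : i < r -> [/\ ee i `<=` F `|` G i, E (ee i), exists2 x, x \in ee i & x \in G i & f \in ee i].
  by move=> /eeP[]; rewrite in_newE => /and3P[? ? /meetP ?].
exists ee; split=> [i|i|i|i j ir jr ij eqe]; try by move/P=> [].
have [_ _ [x xi xG] _] := P i ir; have [ej _ _ _] := P j jr.
move: (fsubsetP ej x); rewrite -eqe inE xi => /(_ isT) /orP[xF|xj].
  by have [/fdisjointP/(_ x xF)] := pr i ir; rewrite xG.
by move/fdisjointP/(_ x xG): (di i j ir jr ij); rewrite xj.
Qed.

Lemma str_le E m m' A : m' <= m -> str w E m A -> str w E m' A.
Proof. by move=> le sA Z dZ cZ; apply: sA => //; apply: leq_trans le. Qed.

Lemma str_ext E m A X : fdisjoint A X -> #|` X| <= w * #|` newE E A X| ->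
  str w E (#|` X| + m) A -> str w E m (A `|` X).
Proof.
move=> dAX cX sA Z dZ cZ.
have dXZ : fdisjoint X Z by fset_tac.
have dAXZ : fdisjoint A (X `|` Z) by fset_tac.
have le : #|` X| + #|` Z| <= #|` X| + m by lia.
move: (sA _ dAXZ); rewrite card_disj // => /(_ le).
by rewrite card_newE_split // mulnDr; lia.
Qed.

Lemma newE_gt0 E A X e : e `<=` A `|` X -> E e -> ~~ fdisjoint e X -> 0 < #|` newE E A X|.
Proof. by move=> es Ee eX; rewrite cardfs_gt0; apply/fset0Pn; exists e; rewrite in_newE es Ee. Qed.

(** A block with three points in A would have at most w - 1 points outside, fewer than the w that
    one block costs. *)
Lemma str_block e A m : w <= m -> str w L m A -> L e -> 2 < #|` e `&` A| -> e `<=` A.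
Proof.
move=> wm sA Le lt; apply: contraT => neA.
have dZ : fdisjoint A (e `\` A) by fset_tac.
have cZ := cardfsID A e; rewrite (L_size Le) in cZ.
have n0 : 0 < #|` newE L A (e `\` A)|.
  apply: (newE_gt0 _ Le); first by fset_tac.
  by move/fsubsetPn: neA => [x xe xA]; apply/meetP; exists x; rewrite // !inE xA xe.
have cZm : #|` e `\` A| <= m by lia.
by have := sA _ dZ cZm; nia.
Qed.

Lemma fresh_set A n : exists2 X, fdisjoint A X & #|` X| = n.
Proof.
have [N bN] := below_ex A; exists ((fun i => N + i) @` [fset i in iota 0 n]).
  apply/fdisjointP=> x /bN xN; apply/negP => /imfsetP[y /= _ eqx]; lia.
rewrite card_imfset /=; last exact: addnI.
by rewrite card_fseq undup_id ?iota_uniq // size_iota.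
Qed.

Lemma newE_le1 E A X : #|` A `|` X| <= w.+2 -> (forall e, E e -> #|` e| = w.+2) ->
  forall e, e \in newE E A X -> e = A `|` X.
Proof.
move=> c sz e; rewrite in_newE => /and3P[es Ee _]; apply/eqP; rewrite eqEfcard es /=.
by rewrite (sz _ Ee).
Qed.

(** Over an unjoined pair, a block with w fresh points is 0-primitive. Adding it would join the
    pair, and every obstruction to adding it is contradictory too. *)
Lemma pair_block a b : a != b -> exists2 e, L e & (a \in e) && (b \in e).
Proof.
move=> ab; apply: contrapT => nex.
have no e : L e -> a \in e -> b \in e -> False.
  by move=> Le ae be; apply: nex; exists e => //; rewrite ae.
pose A := [fset a; b].
have cA : #|` A| = 2 by rewrite cardfs2 ab.
have [aA bA] : a \in A /\ b \in A by rewrite !inE !eqxx orbT.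
have [X dAX cX] := fresh_set A w.
have cAX : #|` A `|` X| = w.+2 by rewrite card_disj // cA cX.
have X0 : X != fset0 by rewrite -cardfs_gt0 cX.
pose E1 e := e == A `|` X.
have newX : newE E1 A X = [fset A `|` X].
  apply/fsetP=> e; rewrite in_newE in_fset1 /E1; case: eqP => [->|]; rewrite ?andbF //.
  rewrite fsubset_refl /=; have /fset0Pn[x xX] := X0.
  by apply/meetP; exists x; rewrite // inE xX orbT.
have prX : prim w E1 A X.
  split; rewrite ?newX ?cardfs1 ?muln1 // => Y YX Y0 nYX.
  suff -> : newE E1 A Y = fset0 by rewrite cardfs0 muln0 cardfs_gt0.
  apply/fsetP=> e; rewrite in_newE in_fset0 /E1; apply/negbTE/negP => /and3P[es /eqP eqe _].
  by move/negP: nYX; apply; rewrite eqEfsubset YX /=; rewrite eqe in es; fset_tac.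
have noA : forall e, e `<=` A -> #|` e| <> w.+2.
  by move=> e /fsubset_leq_card; rewrite cA; lia.
have isoA : iso E1 L id A.
  split=> // e eA; rewrite imfset_id; apply/eqP/idP => [eqe|/L_size sz].
    by case: (noA _ eA); rewrite eqe.
  by case: (noA _ eA).
have sz1 e : e \in newE E1 A X -> #|` e| = w.+2 by rewrite newX => /fset1P ->.
have lin1 e1 e2 : e1 \in newE E1 A X -> e2 \in newE E1 A X -> 1 < #|` e1 `&` e2| -> e1 = e2.
  by rewrite newX => /fset1P-> /fset1P->.
have lin01 e e2 : e \in newE E1 A X -> L e2 -> #|` e2 `&` id @` (e `&` A)| <= 1.
  rewrite imfset_id => _ Le2; rewrite leqNgt; apply/negP => lt.
  have sub : e2 `&` (e `&` A) `<=` A by apply/fsubsetP => x; rewrite !inE => /and3P[].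
  have /eqP eqA : e2 `&` (e `&` A) == A by rewrite eqEfcard sub cA.
  apply: (no e2) => //.
    by move: aA; rewrite -{1}eqA inE => /andP[].
  by move: bA; rewrite -{1}eqA inE => /andP[].
have strA : str w L #|` X| (id @` A).
  rewrite imfset_id => Z dZ; rewrite cX => cZ.
  (* With at most w points in Z, a block new over the pair fills A and Z entirely, so it would join
     a and b. *)
  suff -> : newE L A Z = fset0 by rewrite cardfs0 muln0.
  apply/fsetP=> e; rewrite in_fset0; apply/negbTE/negP => eN.
  have eq : e = A `|` Z.
    by apply: (newE_le1 _ L_size eN); rewrite card_disj // cA; lia.
  move: eN; rewrite in_newE => /and3P[_ Le _].
  by apply: (no e) => //; rewrite eq inE ?aA ?bA.
have [i [D [psi [[_ bdA] pi [psA psX] DE out]]]] :=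
  visit w_gt0 mu_ge 0 prX isoA sz1 lin1 lin01 strA.
rewrite imfset_id in out.
have pA : psi @` A = A by rewrite -[RHS]imfset_id; apply: eq_in_imfset => x /psA.
have pAX : psi @` (A `|` X) = A `|` psi @` X by rewrite imfsetU pA.
case: out => [[piL _]|[F [G [r [mur cop H]]]]].
  apply: (no (psi @` (A `|` X))); last 2 first.
  - by rewrite pAX inE aA.
  - by rewrite pAX inE bA.
  by rewrite -piL.2 ?fsubset_refl // /E1 eqxx.
have rF := mu_ge #|` F|; have [pr ba di _] := cop.
have onlyD e : D e -> e `<=` A `|` psi @` X -> e = A `|` psi @` X.
  move=> De; rewrite -pAX => sub; have eqe := imfset_preim sub.
  rewrite eqe; set e' := [fset x in _ | _] in eqe *.
  suff -> : e' = A `|` X by [].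
  apply/eqP; rewrite -/(E1 e') pi.2 -?eqe //.
  by apply/fsubsetP=> x; rewrite !inE => /andP[].
(* If F contains a fresh point f, two distinct blocks through f lie within A and the fresh points,
   which carry a single block. *)
case: H => [[FA [j jr Gj]]|[f [fF fX FAX GAX]]]; last first.
  have [ee [eD fe eFG ne]] := copies_degree cop fF.
  have r0 : 0 < r by lia.
  have r1 : 1 < r by lia.
  have AXs l : l < r -> ee l `<=` A `|` psi @` X.
    by move=> lr; apply: fsubset_trans (eFG _ lr) _; rewrite fsubUset FAX GAX.
  apply: (ne 0 1 r0 r1); first by [].
  by rewrite (onlyD _ (eD _ r0) (AXs _ r0)) (onlyD _ (eD _ r1) (AXs _ r1)).
(* Another copy avoids the fresh points, so its blocks are old. It has w points, so a block on it
   fills A and the copy, and joins a and b. *)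
pose l := if j == 0 then 1 else 0.
have lr : l < r by rewrite /l; case: ifP; lia.
have lj : l <> j by rewrite /l; case: eqP; lia.
have cG : #|` G l| = w.
  by rewrite -cX -(copies_card cop jr lr) Gj (card_imfset_in pi.1) // fsubsetUr.
have [_ _ c _] := pr l lr; rewrite cG in c.
have /fset0Pn[e] : newE D F (G l) != fset0.
  by apply/eqP => n0; rewrite n0 cardfs0 muln0 in c; have := w_gt0; rewrite c.
rewrite in_newE => /and3P[es De eG].
have dAX' : fdisjoint A (psi @` X).
  by rewrite -{1}pA (imfset_disj_in pi.1) ?fsubsetUl ?fsubsetUr.
have dlj := di l j lr jr lj; rewrite Gj in dlj.
have Le : L e.
  by apply: (@limit_stage w mu i); rewrite -DE //; fset_tac.
have cAG : #|` A `|` G l| <= w.+2 by rewrite cardfsU cA cG leq_subr.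
have eqe : e = A `|` G l.
  apply/eqP; rewrite eqEfcard (L_size Le) cAG andbT.
  by apply: fsubset_trans es _; rewrite fsetSU.
by apply: (no e); rewrite // eqe inE ?aA ?bA.
Qed.

Lemma rest_le p q r : 1 < p -> p + q = r.+2 -> q <= r.
Proof. lia. Qed.

(** A block with two points in A has at most w new ones, which already have dimension at most 0; by
    primitivity they are all of X. *)
Lemma prim_line E A X e : (forall e, E e -> #|` e| = w.+2) -> prim w E A X ->
  e \in newE E A X -> 1 < #|` e `&` A| ->
  [/\ X `<=` e, #|` X| = w, newE E A X = [fset e] & #|` e `&` A| = 2].
Proof.
move=> sz [dAX X0 cX small] eN lt; move: (eN); rewrite in_newE => /and3P[es Ee eX].
have cE := sz e Ee; have dE : e `\` A `<=` X by fset_tac.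
have cI := cardfsID A e; rewrite cE in cI.
have eN' : e \in newE E A (e `\` A).
  rewrite in_newE Ee /=; apply/andP; split; first by fset_tac.
  case/meetP: eX => x xe xX; apply/meetP; exists x => //; rewrite inE xe andbT.
  by apply/negP => /(fdisjointP dAX); rewrite xX.
have n0 : 0 < #|` newE E A (e `\` A)| by rewrite cardfs_gt0; apply/fset0Pn; exists e.
have eqX : e `\` A = X.
  apply/eqP; apply: contraT => neq.
  have nz : e `\` A != fset0.
    case/meetP: eX => x xe xX; apply/fset0Pn; exists x; rewrite inE xe andbT.
    by apply/negP => /(fdisjointP dAX); rewrite xX.
  have lew : #|` e `\` A| <= w by exact: rest_le lt cI.
  by have := small _ dE nz neq; rewrite ltnNge (leq_trans lew) // leq_pmulr.
rewrite eqX in n0 cI.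
have c1 : #|` newE E A X| = 1 by nia.
rewrite c1 muln1 in cX; split=> //.
- by rewrite -eqX fsubsetDl.
- by move/eqP/cardfs1P: c1 eN => [a ->] /fset1P ->.
- lia.
Qed.

Lemma bij_fset (X Y : {fset nat}) : #|` X| = #|` Y| ->
  exists2 g : nat -> nat, {in X &, injective g} & g @` X = Y.
Proof.
move=> cXY; exists (fun x => nth 0 Y (index x X)).
  move=> x y xX yX /eqP; rewrite nth_uniq ?fset_uniq -?cXY ?index_mem // => /eqP eqi.
  by rewrite -(nth_index 0 xX) eqi nth_index.
apply/fsetP=> y; apply/imfsetP/idP => [[x /= xX ->]|yY].
  by rewrite mem_nth // -cXY index_mem.
exists (nth 0 X (index y Y)) => /=; first by rewrite mem_nth // cXY index_mem.
by rewrite index_uniq ?fset_uniq ?nth_index // cXY index_mem.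
Qed.

Definition join A h g x : nat := if x \in A then h x else g x.

Lemma join_inj A X h g : {in A &, injective h} -> {in X &, injective g} ->
  fdisjoint (h @` A) (g @` X) -> {in A `|` X &, injective (join A h g)}.
Proof.
move=> hi gi dhg x y; rewrite /join !in_fsetU.
have ne u v : u \in A -> v \in X -> h u <> g v.
  move=> uA vX eqhg; have := fdisjointP dhg (h u).
  by rewrite {2}eqhg !in_imfset // => /(_ isT).
case: ifP => /= xA; case: ifP => /= yA; first by move=> _ _; apply: hi.
- by move=> _ yX eqxy; case: (ne _ _ xA yX).
- by move=> xX _ eqxy; case: (ne _ _ yA xX).
- exact: gi.
Qed.

Lemma iso_join E E' A X h g : iso E E' h A -> {in X &, injective g} ->
  fdisjoint (h @` A) (g @` X) ->
  (forall e, e `<=` A `|` X -> ~~ fdisjoint e X -> E e = E' (join A h g @` e)) ->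
  iso E E' (join A h g) (A `|` X).
Proof.
move=> [hi hE] gi dhg EX; split=> [|e eAX]; first exact: join_inj.
case: (boolP (fdisjoint e X)) => eX; last exact: EX.
have eA : e `<=` A by fset_tac.
rewrite hE //; congr (E' _); apply: eq_in_imfset => x /(fsubsetP eA).
by rewrite /join => ->.
Qed.

Lemma iso_newE_eq E E' A B X Y h : iso E E' h (A `|` X) -> h @` A = B -> h @` X = Y ->
  #|` newE E' B Y| = #|` newE E A X|.
Proof. by move=> hiso <- <-; apply: iso_card_newE hiso _; apply: fsubset_refl. Qed.

(* A fresh copy of such an extension could create a second block through a pair
   of old points; instead the block that already joins the pair is used. *)
Lemma extend_line A X h e : prim w L A X -> iso L L h A -> str w L #|` X| (h @` A) ->
  e \in newE L A X -> 1 < #|` e `&` A| ->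
  exists2 g, iso L L g (A `|` X) & {in A, g =1 h}.
Proof.
move=> prX hA sB eN lt.
have [Xe cX newX c2] := prim_line L_size prX eN lt.
have [dAX X0 _ _] := prX.
move: (eN); rewrite in_newE => /and3P[es Le _].
have /cardfs_gt1P[a [b [ab]]] := lt; rewrite !inE => /andP[ae aA] /andP[be bA].
have hab : h a != h b by apply: contraNneq ab => /hA.1 ->.
have [e2 Le2 /andP[ha hb]] := pair_block hab.
have eAsub : e `&` A `<=` A by exact: fsubsetIr.
(* Otherwise [e2] would pull back to a block inside A sharing a and b with e, hence equal to e,
   although e contains points of X. *)
have ne2 : ~~ (e2 `<=` h @` A).
  apply/negP => sub; have eq2 := imfset_preim sub; set e1 := [fset x in A | _] in eq2.
  have e1A : e1 `<=` A by apply/fsubsetP=> x; rewrite !inE => /andP[].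
  have Le1 : L e1 by rewrite hA.2 // -eq2.
  have eq1 : e1 = e.
    apply: L_linear => //; apply/cardfs_gt1P; exists a, b; split; rewrite // !inE /=.
      by rewrite aA ha ae.
    by rewrite bA hb be.
  by case/fset0Pn: X0 => x xX; have := fsubsetP e1A x; rewrite eq1 (fsubsetP Xe) // => /(_ isT)/(fdisjointP dAX); rewrite xX.
set Z := e2 `\` h @` A.
have dZ : fdisjoint (h @` A) Z by rewrite /Z; fset_tac.
have c3 : #|` e2 `&` h @` A| <= 2.
  by rewrite leqNgt; apply: contra ne2; apply: str_block sB Le2; rewrite cX.
have cI : [fset h a; h b] = e2 `&` h @` A.
  apply/eqP; rewrite eqEfcard cardfs2 hab c3 andbT.
  by apply/fsubsetP=> x; rewrite !inE => /orP[]/eqP->; rewrite ?ha ?hb in_imfset.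
have cZ : #|` Z| = w.
  by have := cardfsID (h @` A) e2; rewrite (L_size Le2) -cI cardfs2 hab => -[].
have heA : h @` (e `&` A) = e2 `&` h @` A.
  rewrite -cI; apply/esym/eqP; rewrite eqEfcard (card_imfset_in hA.1) // c2 cardfs2 hab andbT.
  by apply/fsubsetP=> x; rewrite !inE => /orP[]/eqP->; rewrite in_imfset // inE ?ae ?be.
have e2N : e2 \in newE L (h @` A) Z.
  rewrite in_newE Le2 /=; apply/andP; split; first by rewrite /Z; fset_tac.
  by move/fsubsetPn: ne2 => [x xe xA]; apply/meetP; exists x; rewrite // !inE xA xe.
have newZ : newE L (h @` A) Z = [fset e2].
  apply/esym/eqP; rewrite eqEfcard fsub1set e2N cardfs1 /=.
  have := sB _ dZ; rewrite cZ cX leqnn => /(_ isT).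
  by rewrite -[X in _ <= X]muln1 leq_pmul2l.
have [g gi gX] : exists2 g : nat -> nat, {in X &, injective g} & g @` X = Z.
  by apply: bij_fset; rewrite cX cZ.
have jim f : f `<=` A `|` X -> join A h g @` f = h @` (f `&` A) `|` g @` (f `&` X).
  move=> fAX; have eqf : (f `&` A) `|` (f `&` X) = f by rewrite -fsetIUr; apply/fsetIidPl.
  transitivity (join A h g @` ((f `&` A) `|` (f `&` X))); first by rewrite eqf.
  rewrite imfsetU; congr (_ `|` _); apply: eq_in_imfset => x; rewrite inE /join => /andP[_].
    by move=> ->.
  by case: ifP => // xA xX; have := fdisjointP dAX x xA; rewrite xX.
have je : join A h g @` e = e2.
  rewrite jim // heA (fsetIidPr Xe) gX /Z; exact: fsetID.
exists (join A h g); last by move=> x xA; rewrite /join xA.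
have hg : fdisjoint (h @` A) (g @` X) by rewrite gX.
have ji := join_inj hA.1 gi hg.
apply: iso_join => //.
move=> f fAX fX; apply/idP/idP => [Lf|Ljf].
  have : f \in newE L A X by rewrite in_newE fAX Lf.
  by rewrite newX => /fset1P ->; rewrite je.
have : join A h g @` f \in newE L (h @` A) Z.
  rewrite in_newE Ljf /=; apply/andP; split.
    by rewrite jim // -gX fsetUSS // imfsetS // fsubsetIr.
  case/meetP: fX => x xf xX; apply/meetP; exists (join A h g x); rewrite ?in_imfset //.
  rewrite -gX /join; case: ifP => [xA|_]; last by rewrite in_imfset.
  by have := fdisjointP dAX x xA; rewrite xX.
by rewrite newZ => /fset1P; rewrite -je => /(imfset_inj_in ji) ->.
Qed.

End Extension.

(** * Realising extensions through towers of 0-primitive ones *)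

Section Towers.
Variables (w : nat) (mu : nat -> nat).
Hypothesis w_gt0 : 0 < w.
Hypothesis mu_ge : forall p, p + 2 <= mu p.
Implicit Types (E : {fset nat} -> bool) (A B F X Y Z S e : {fset nat}).
Implicit Types (G : nat -> {fset nat}) (h : nat -> nat).

Notation L := (limit w mu).

(** X has dimension 0 over both sets, so the two families of blocks have equal size and the
    inclusion is an equality. *)
Lemma newE_base E A F X : prim w E A X -> prim w E F X -> F `<=` A ->
  newE E A X = newE E F X.
Proof.
move=> [_ _ cA _] [_ _ cF _] FA; apply/esym/eqP; rewrite eqEfcard.
rewrite newE_sub //=; last by fset_tac.
by move: cA; rewrite cF => /eqP; rewrite eqn_pmul2l // => /eqP->.
Qed.

Lemma disjoint_subU e F B X Y : e `<=` F `|` Y -> F `<=` B ->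
  fdisjoint B X -> fdisjoint Y X -> fdisjoint e X.
Proof. by move=> *; fset_tac. Qed.

(** If the fresh copy is refused, it is one of too many copies over a base F inside the image of A.
    Another of these copies is disjoint from that image and lies in the limit; it serves as the
    image of X. *)
Lemma extend_prim A X h : prim w L A X -> iso L L h A -> str w L #|` X| (h @` A) ->
  exists2 g, iso L L g (A `|` X) & {in A, g =1 h}.
Proof.
move=> prX hA sB.
case: (pselect (exists2 e, e \in newE L A X & 1 < #|` e `&` A|)) => [[e eN lt]|nline].
  exact: (extend_line w_gt0 mu_ge prX hA sB eN lt).
have few e : e \in newE L A X -> #|` e `&` A| <= 1.
  by move=> eN; rewrite leqNgt; apply/negP => lt; apply: nline; exists e.
have sz e : e \in newE L A X -> #|` e| = w.+2 by rewrite in_newE => /and3P[_ /(L_size w_gt0)].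
have lin e1 e2 : e1 \in newE L A X -> e2 \in newE L A X -> 1 < #|` e1 `&` e2| -> e1 = e2.
  by rewrite !in_newE => /and3P[_ L1 _] /and3P[_ L2 _]; apply: (L_linear w_gt0 L1 L2).
have lin01 e e2 : e \in newE L A X -> L e2 -> #|` e2 `&` h @` (e `&` A)| <= 1.
  move=> eN _; apply: leq_trans (few e eN).
  by apply: leq_trans (fsubset_leq_card (fsubsetIr _ _)) (leq_imfset_card _ _ _).
have [i [D [psi [[_ bdA] pi [psA psX] DE out]]]] := visit w_gt0 mu_ge 0 prX hA sz lin lin01 sB.
case: out => [[piL _]|[F [G [r [mur cop H]]]]]; first by exists psi.
have [pr ba di ii] := cop.
have pA : psi @` A = h @` A by apply: eq_in_imfset => x /psA.
have [dAX _ _ _] := prX.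
have cpX : #|` psi @` X| = #|` X| by rewrite (card_imfset_in pi.1) // fsubsetUr.
have [_ _ _ cpL] := klass_limit mu w_gt0.
(* Were all copies inside the base and the fresh points, the inverse of [psi] would carry them into
   the limit, against the bound mu. This also disposes of the last case of the trichotomy. *)
have outside : F `<=` h @` A `|` psi @` X -> exists2 j, j < r & ~~ (G j `<=` h @` A `|` psi @` X).
  move=> FAX; apply: contrapT => nex.
  have GAX j : j < r -> G j `<=` h @` A `|` psi @` X.
    by move=> jr; apply: contraT => n; case: nex; exists j.
  have [q qK] := imfset_linv pi.1.
  have piq := iso_inv pi qK; rewrite imfsetU pA in piq.
  have := copies_iso piq FAX GAX cop => /cpL.
  by rewrite (card_imfset_in piq.1) // leqNgt mur.
have {H outside} [FA [i0 i0r Gi0] [j jr Gj]] : [/\ F `<=` h @` A,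
    exists2 i, i < r & G i = psi @` X & exists2 j, j < r & ~~ (G j `<=` h @` A `|` psi @` X)].
  case: H => [[FA Gi]|[f [_ _ FAX GAX]]].
    by split=> //; apply: outside; apply: fsubset_trans FA (fsubsetUl _ _).
  by have [j jr] := outside FAX; rewrite GAX.
have ji0 : j <> i0 by move=> eqj; move: Gj; rewrite eqj Gi0 fsubsetUr.
have dGX : fdisjoint (G j) (psi @` X) by rewrite -Gi0; apply: di.
have cG : #|` G j| = #|` X| by rewrite (copies_card cop jr i0r) Gi0.
have dBX : fdisjoint (h @` A) (psi @` X).
  by rewrite -pA (imfset_disj_in pi.1) ?fsubsetUl ?fsubsetUr.
have DL e : fdisjoint e (psi @` X) -> D e -> L e.
  by move=> de; rewrite DE //; apply: limit_stage.
(* If the copy met the image of A, its part outside would have negative dimension over that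
   image. *)
have dBG : fdisjoint (h @` A) (G j).
  apply: contraT => nd; set Y := G j `&` h @` A; set Z := G j `\` h @` A.
  have Y0 : Y != fset0 by rewrite fsetI_eq0 /fdisjoint fsetIC.
  have Z0 : Z != fset0.
    rewrite fsetD_eq0; apply: contra Gj => s; apply: fsubset_trans s (fsubsetUl _ _).
  have dYZ : fdisjoint Y Z by rewrite /Y /Z; fset_tac.
  have lt := prim_rest (pr _ jr) (fsetID _ _) dYZ Y0 Z0.
  have dZ : fdisjoint (h @` A) Z by rewrite /Z; fset_tac.
  have cZ : #|` Z| <= #|` X| by rewrite -cG; apply/fsubset_leq_card/fsubsetDl.
  apply: (lt_mul_absurd lt _ (sB _ dZ cZ)); apply/fsubset_leq_card/fsubsetP=> e.
  rewrite !in_newE => /and3P[es De ->]; rewrite andbT.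
  have eBZ : e `<=` h @` A `|` Z by rewrite /Y /Z in es *; fset_tac.
  by rewrite eBZ; apply: DL De; rewrite /Z in eBZ; fset_tac.
have [s si [sF sG]] := ii i0 j i0r jr; rewrite Gi0 in si sG.
have prB : prim w D (h @` A) (psi @` X) by rewrite -pA; apply: prim_iso pi _ prX; apply: fsubset_refl.
have prF : prim w D F (psi @` X) by rewrite -Gi0; exact: pr.
have newB := newE_base prB prF FA.
(* Self-sufficiency leaves no room for further blocks between [G j] and points of the image outside
   F. *)
have newG : newE L (h @` A) (G j) = newE D F (G j).
  apply/esym/eqP; rewrite eqEfcard; apply/andP; split.
    apply/fsubsetP=> e; rewrite !in_newE => /and3P[es De ->]; rewrite andbT.
    rewrite (fsubset_trans es (fsetSU _ FA)) /=.
    by apply: DL De; exact: disjoint_subU es FA dBX dGX.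
  have [_ _ c _] := pr j jr; have := sB _ dBG; rewrite cG leqnn => /(_ isT).
  by rewrite -cG c leq_pmul2l.
have gX : (s \o psi) @` X = G j by rewrite (imfset_comp _ psi s) sG.
have gi : {in X &, injective (s \o psi)}.
  move=> x y xX yX /= /si.1; rewrite !in_fsetU !in_imfset // !orbT => /(_ isT isT).
  by apply: pi.1; rewrite inE ?xX ?yX orbT.
have dhg : fdisjoint (h @` A) ((s \o psi) @` X) by rewrite gX.
have jim e : e `<=` A `|` X -> (forall x, x \in e -> x \in A -> h x \in F) ->
    join A h (s \o psi) @` e = s @` (psi @` e).
  move=> eAX eF; rewrite -(imfset_comp _ psi s); apply: eq_in_imfset => x xe.
  by rewrite /join /=; case: ifP => // xA; rewrite psA // sF // eF.
exists (join A h (s \o psi)); last by move=> x xA; rewrite /join xA.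
apply: iso_join => // e eAX eX.
have pmeet : ~~ fdisjoint (psi @` e) (psi @` X).
  by case/meetP: eX => x xe xX; apply/meetP; exists (psi x); rewrite in_imfset.
have eF_of : psi @` e `<=` F `|` psi @` X -> forall x, x \in e -> x \in A -> h x \in F.
  move=> sub x xe xA; have := fsubsetP sub (psi x); rewrite in_imfset // => /(_ isT).
  rewrite psA // inE => /orP[//|hX].
  by have := fdisjointP dBX (h x); rewrite in_imfset // hX => /(_ isT).
apply/idP/idP => [Le|Lj].
  have : psi @` e \in newE D (h @` A) (psi @` X).
    by rewrite in_newE -pi.2 // Le pmeet -pA -imfsetU imfsetS.
  rewrite newB in_newE => /and3P[es De _].
  have se : s @` (psi @` e) `<=` F `|` G j.
    apply: fsubset_trans (imfsetS s es) _; rewrite imfsetU sG fsetSU //.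
    by apply/fsubsetP=> _ /imfsetP[x /= xF ->]; rewrite sF.
  rewrite jim //; last exact: eF_of.
  by apply: DL; [exact: disjoint_subU se FA dBX dGX | rewrite -si.2].
have je : join A h (s \o psi) @` e \in newE D F (G j).
  rewrite -newG in_newE Lj /=; apply/andP; split.
    apply/fsubsetP=> _ /imfsetP[x /= xe ->]; rewrite /join inE -gX.
    case: ifP => xA; first by rewrite in_imfset.
    by have := fsubsetP eAX x xe; rewrite inE xA /= => xX; rewrite orbC in_imfset.
  case/meetP: eX => x xe xX; apply/meetP; exists (join A h (s \o psi) x); rewrite ?in_imfset //.
  rewrite -gX /join; case: ifP => [xA|_]; last by rewrite in_imfset.
  by have := fdisjointP dAX x xA; rewrite xX.
move: je; rewrite in_newE => /and3P[jes Dj _].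
have eF x : x \in e -> x \in A -> h x \in F.
  move=> xe xA; have := fsubsetP jes (join A h (s \o psi) x).
  rewrite in_imfset // => /(_ isT); rewrite /join xA inE => /orP[//|hG].
  by have := fdisjointP dBG (h x); rewrite in_imfset // hG => /(_ isT).
have pes : psi @` e `<=` F `|` psi @` X.
  apply/fsubsetP=> _ /imfsetP[x /= xe ->]; rewrite inE.
  have := fsubsetP eAX x xe; rewrite inE => /orP[xA|xX]; last by rewrite orbC in_imfset.
  by rewrite psA // eF.
by rewrite pi.2 // si.2 // -jim //.
Qed.

(** A nonempty part of least size among those of dimension at most 0 is 0-primitive. Iterating this
    splits Z into a tower for [extend]. *)
Lemma str_min A Z : fdisjoint A Z -> Z != fset0 -> str w L #|` Z| A ->
  #|` Z| <= w * #|` newE L A Z| -> exists2 X, X `<=` Z & prim w L A X.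
Proof.
move=> dAZ Z0 sA cZ.
pose Q n := `[< exists X, [/\ X `<=` Z, X != fset0, #|` X| <= w * #|` newE L A X| & #|` X| = n] >].
have exQ : exists n, Q n by exists #|` Z|; apply/asboolP; exists Z; split.
case: (ex_minnP exQ) => n /asboolP[X [XZ X0 cX nX]] nmin; exists X => //.
have le Y : Y `<=` Z -> w * #|` newE L A Y| <= #|` Y|.
  by move=> YZ; apply: sA; [fset_tac | exact: fsubset_leq_card].
split=> //; first by fset_tac.
  by apply/eqP; rewrite eqn_leq cX le.
move=> Y YX Y0 nYX; rewrite ltn_neqAle le ?(fsubset_trans YX) // andbT.
apply/eqP => eqY; have /nmin : Q #|` Y|.
  by apply/asboolP; exists Y; split; rewrite ?eqY ?leqnn // (fsubset_trans YX).
rewrite -nX leqNgt => /negP; apply.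
by apply: fproper_ltn_card; rewrite fproperEneq nYX.
Qed.

Lemma extend A Z h : fdisjoint A Z -> #|` Z| <= w * #|` newE L A Z| ->
  str w L #|` Z| A -> iso L L h A -> str w L #|` Z| (h @` A) ->
  exists2 g, iso L L g (A `|` Z) & {in A, g =1 h}.
Proof.
move: {2}#|` Z| (leqnn #|` Z|) => n; elim: n => [|n IH] in A Z h *.
  by rewrite leqn0 cardfs_eq0 => /eqP-> *; exists h; rewrite ?fsetU0.
move=> cZn dAZ cZ sA hA sB; have [->|Z0] := eqVneq Z fset0; first by exists h; rewrite ?fsetU0.
have [X XZ prX] := str_min dAZ Z0 sA cZ.
have [dAX X0 cX _] := prX.
have cXZ := fsubset_leq_card XZ.
have [g gi gh] := extend_prim prX hA (str_le cXZ sB).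
have ZX : X `|` (Z `\` X) = Z by fset_tac.
have cs : #|` X| + #|` Z `\` X| = #|` Z| by rewrite -card_disj ?ZX //; fset_tac.
have gA : g @` A = h @` A by apply: eq_in_imfset => x /gh.
have dgX : fdisjoint (h @` A) (g @` X) by rewrite -gA (imfset_disj_in gi.1) ?fsubsetUl ?fsubsetUr.
have cgX : #|` g @` X| = #|` X| by rewrite (card_imfset_in gi.1) ?fsubsetUr.
have dd : fdisjoint (A `|` X) (Z `\` X) by fset_tac.
have X1 : 0 < #|` X| by rewrite cardfs_gt0.
have c1 : #|` Z `\` X| <= n by rewrite -ltnS; apply: leq_trans cZn; rewrite -cs -add1n leq_add2r.
have c2 : #|` Z `\` X| <= w * #|` newE L (A `|` X) (Z `\` X)|.
  have eqn := card_newE_split L dd; rewrite ZX in eqn.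
  by move: cZ; rewrite eqn mulnDr -cX -cs leq_add2l.
have s1 : str w L #|` Z `\` X| (A `|` X) by apply: str_ext; rewrite ?cs -?cX.
have s2 : str w L #|` Z `\` X| (g @` (A `|` X)).
  rewrite imfsetU gA; apply: str_ext => //; rewrite ?cgX ?cs //.
  by rewrite (iso_newE_eq gi gA erefl) -cX.
have [k ki kg] := IH _ _ _ c1 dd c2 s1 gi s2.
exists k; first by rewrite -fsetUA ZX in ki.
by move=> x xA; rewrite kg ?gh // inE xA.
Qed.

End Towers.

(** * Finiteness of the dimension closure *)

Section Finiteness.
Variables (w : nat) (mu : nat -> nat).
Hypothesis w_gt0 : 0 < w.
Hypothesis mu_ge : forall p, p + 2 <= mu p.
Implicit Types (E : {fset nat} -> bool) (A B F X Y Z S e : {fset nat}).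
Implicit Types (G : nat -> {fset nat}) (h : nat -> nat).

Notation L := (limit w mu).

Lemma bounded_or_uniq (T : eqType) (Q : T -> Prop) g :
  (exists2 s : seq T, size s <= g & forall x, Q x -> x \in s) \/
  (exists s : seq T, [/\ uniq s, size s = g.+1 & forall x, x \in s -> Q x]).
Proof.
elim: g => [|g [[s sg Qs]|[s [us ss Qs]]]].
- case: (pselect (exists x, Q x)) => [[x Qx]|nex].
    by right; exists [:: x]; split=> // y; rewrite inE => /eqP->.
  by left; exists [::] => // x Qx; case: nex; exists x.
- by left; exists s => //; apply: leqW.
case: (pselect (exists2 x, Q x & x \notin s)) => [[x Qx xs]|nex].
  right; exists (x :: s); split; rewrite /= ?xs ?ss // => y.
  by rewrite inE => /predU1P[->|/Qs].
left; exists s; rewrite ?ss // => x Qx; apply: contraT => xs.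
by case: nex; exists x.
Qed.

Lemma pigeonhole (T : eqType) (U : finType) (t : T -> U) (s : seq T) M :
  #|U| * M < size s -> exists u, M < count (fun x => t x == u) s.
Proof.
move=> lt; apply: contrapT => nex; move: lt; rewrite ltnNge => /negP; apply.
rewrite -sum1_size (partition_big t predT) //= -sum_nat_const leq_sum // => u _.
by rewrite sum1_count leqNgt; apply/negP => ?; apply: nex; exists u.
Qed.

(** The structure induced on a list, coded in a finite type for the pigeonhole. The last clause bars
    indices beyond the list, where [nth] returns its default 0. *)
Definition pat k (s : seq nat) : {set {set 'I_k}} :=
  [set J : {set 'I_k} | L [fset nth 0 s (j : 'I_k) | j in J] &&
    [forall j in J, j < size s]].

Lemma pat_iso k (s s' : seq nat) : uniq s -> uniq s' -> size s = size s' -> size s <= k ->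
  pat k s = pat k s' -> iso L L (fun y => nth 0 s' (index y s)) [fset x in s].
Proof.
move=> us us' ss sk eqp.
have mem y : y \in [fset x in s] = (y \in s) by rewrite !inE.
split=> [x y|e es].
  rewrite !mem => xs ys /eqP; rewrite nth_uniq -?ss ?index_mem // => /eqP eqi.
  by rewrite -(nth_index 0 xs) eqi nth_index.
pose J := [set j : 'I_k | (j < size s) && (nth 0 s j \in e)].
have ys y : y \in e -> y \in s by move=> ye; rewrite -mem (fsubsetP es).
have lt y : y \in e -> index y s < k by move=> /ys; rewrite -index_mem => /leq_trans; apply.
have JE y (ye : y \in e) : Ordinal (lt y ye) \in J.
  by rewrite inE /= index_mem ys // nth_index ?ys.
have e1 : e = [fset nth 0 s (j : 'I_k) | j in J].
  apply/fsetP=> y; apply/idP/imfsetP => [ye|[j /=]].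
    by exists (Ordinal (lt y ye)); rewrite ?JE //= nth_index ?ys.
  by rewrite inE => /andP[_ je] ->.
have e2 : (fun y => nth 0 s' (index y s)) @` e = [fset nth 0 s' (j : 'I_k) | j in J].
  apply/fsetP=> z; apply/imfsetP/imfsetP => [[y /= ye ->]|[j /=]].
    by exists (Ordinal (lt y ye)); rewrite ?JE.
  by rewrite inE => /andP[js je] ->; exists (nth 0 s j); rewrite //= index_uniq.
have JP : [forall j in J, j < size s] by apply/forall_inP => j; rewrite inE => /andP[].
move/setP/(_ J): eqp; rewrite !inE -ss JP !andbT -e2 => <-.
by rewrite -e1.
Qed.

Definition base E A X : {fset nat} := [fset a in A | [exists e : newE E A X, a \in val e]].

Lemma baseP E A X a : reflect (exists2 e, e \in newE E A X & a \in e /\ a \in A) (a \in base E A X).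
Proof.
rewrite !inE; apply: (iffP andP) => /= [[aA /existsP[e ae]]|[e eN [ae aA]]].
  by exists (val e) => //; exact: valP.
by split=> //; apply/existsP; exists [` eN].
Qed.

Lemma newE_base_eq E A X Y : fdisjoint A X -> Y `<=` X ->
  newE E (base E A X) Y = newE E A Y.
Proof.
move=> dAX YX; have bA : base E A X `<=` A by apply/fsubsetP=> a /baseP[e _ []].
apply/eqP; rewrite eqEfsubset newE_sub //=; last by fset_tac.
apply/fsubsetP=> e; rewrite !in_newE => /and3P[es Ee eY]; rewrite Ee eY !andbT.
apply/fsubsetP=> x xe; have := fsubsetP es x xe; rewrite !in_fsetU => /orP[xA|->]; last by rewrite orbT.
apply/orP; left; apply/baseP; exists e => //; rewrite in_newE Ee; apply/and3P; split=> //.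
  by fset_tac.
by case/meetP: eY => y ye yY; apply/meetP; exists y => //; apply: (fsubsetP YX).
Qed.

Lemma prim_base E A X : prim w E A X -> prim w E (base E A X) X /\ based E (base E A X) X.
Proof.
move=> [dAX X0 cX small]; split; last first.
  move=> a aB; have /baseP[e eN [ae _]] := aB; exists e => //.
  by rewrite newE_base_eq ?fsubset_refl.
split=> //; rewrite ?newE_base_eq ?fsubset_refl //.
  by apply/fdisjointP=> a /baseP[_ _ [_]]; apply: fdisjointP.
by move=> Y YX; rewrite newE_base_eq //; exact: small.
Qed.

(** If they overlap, either primitivity fails outright, or what [X'] has outside X is of negative
    dimension over A and X. The union has up to m + m points, hence the level. *)
Lemma prim_disjoint A X X' m : str w L (m + m) A -> prim w L A X -> prim w L A X' ->
  #|` X| <= m -> #|` X'| <= m -> X <> X' -> fdisjoint X X'.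
Proof.
move=> sA pX pX' cX cX' neX; have [dX X0 eX sX] := pX; have [dX' X0' eX' sX'] := pX'.
apply: contraT => nd; case: (boolP (X' `<=` X)) => [sub|nsub].
  have := sX _ sub X0' _; rewrite eX' ltnn; apply.
  by apply/eqP => eqX; apply: neX.
have I0 : X' `&` X != fset0 by rewrite fsetI_eq0 /fdisjoint fsetIC.
have R0 : X' `\` X != fset0 by rewrite fsetD_eq0.
have dIR : fdisjoint (X' `&` X) (X' `\` X) by fset_tac.
have lt := prim_rest pX' (fsetID X X') dIR I0 R0.
have dU : fdisjoint A (X `|` X' `\` X) by fset_tac.
have dAXR : fdisjoint (A `|` X) (X' `\` X) by fset_tac.
have dXR : fdisjoint X (X' `\` X) by fset_tac.
have cR := fsubset_leq_card (fsubsetDl X' X).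
have cU : #|` X `|` X' `\` X| <= m + m.
  by rewrite card_disj // leq_add // (leq_trans cR).
have := sA _ dU cU; rewrite card_newE_split // card_disj // mulnDr -eX leq_add2l.
apply: (lt_mul_absurd lt); apply/fsubset_leq_card/newE_sub => //.
  by fset_tac.
Qed.

Lemma iso_base A X X' s : iso L L s (A `|` X) -> {in A, s =1 id} -> s @` X = X' ->
  base L A X' = base L A X.
Proof.
move=> si sA sX; have isA : s @` A = A.
  by rewrite -[RHS]imfset_id; apply: eq_in_imfset.
have newX := iso_newE si (fsubset_refl _); rewrite isA sX in newX.
apply/fsetP=> a; apply/baseP/baseP => -[e].
  rewrite newX => /imfsetP[e' /= eN ->] [/imfsetP[x /= xe eqa] aA]; exists e' => //; split=> //.
  move: (eN); rewrite in_newE => /and3P[es _ _].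
  suff -> : a = x by [].
  have aS : a \in A `|` X by rewrite inE aA.
  by apply: (si.1 a x aS (fsubsetP es _ xe)); rewrite -eqa; exact: sA.
move=> eN [ae aA]; exists (s @` e); first by rewrite newX; apply/imfsetP; exists e.
by split=> //; rewrite -(sA a aA) in_imfset.
Qed.

(** Too many extensions would include more than M of one isomorphism type over A. They are disjoint
    with a common base in A, hence copies, and M bounds mu on the possible sizes of that base. *)
Lemma prims_bounded n m : exists g, forall A, #|` A| <= n -> str w L (m + m) A ->
  exists2 s : seq {fset nat}, size s <= g &
    forall X, prim w L A X -> #|` X| <= m -> X \in s.
Proof.
pose M := \max_(p < n.+1) mu p.
pose U := ('I_m.+1 * {set {set 'I_(n + m)}})%type.
exists (#|{: U}| * M) => A cA sA.
case: (bounded_or_uniq (fun X => prim w L A X /\ #|` X| <= m) (#|{: U}| * M)).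
  by move=> [s sg Qs]; exists s => // X pX cX; apply: Qs.
move=> [s [us ss Qs]]; exfalso.
pose code (X : {fset nat}) : U := (inord #|` X|, pat (n + m) (A ++ X)).
have [u] : exists u, M < count (fun X => code X == u) s by apply: pigeonhole; rewrite ss.
rewrite -size_filter; set s' := [seq X <- s | _] => Ms'.
pose G i := nth fset0 s' i.
have us' : uniq s' by rewrite filter_uniq.
have GP i : i < size s' -> [/\ prim w L A (G i), #|` G i| <= m & code (G i) = u].
  by move=> /(mem_nth fset0); rewrite mem_filter => /andP[/eqP cu /Qs[]].
have isoG i j : i < size s' -> j < size s' -> exists2 h, iso L L h (A `|` G i) &
    {in A, h =1 id} /\ h @` G i = G j.
  move=> /GP[[di _ _ _] ci ui] /GP[[dj _ _ _] cj uj].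
  have [cij pij] : #|` G i| = #|` G j| /\ pat (n + m) (A ++ G i) = pat (n + m) (A ++ G j).
    move: ui; rewrite -uj => -[/(congr1 val)]; rewrite /= !inordK ?ltnS //.
  have ucat X : fdisjoint A X -> uniq (A ++ X).
    move=> dX; rewrite cat_uniq !fset_uniq andbT /=.
    by apply/hasPn => x xX; apply/negP => xA; have := fdisjointP dX x xA; rewrite xX.
  have catE X : [fset x in A ++ X] = A `|` X.
    by apply/fsetP=> x; rewrite !inE /= ?mem_cat.
  pose h y := nth 0 (A ++ G j) (index y (A ++ G i)).
  have hi : iso L L h (A `|` G i).
    rewrite -catE; apply: pat_iso pij; rewrite ?ucat // !size_cat ?cij // leq_add //.
  have hA : {in A, h =1 id}.
    by move=> x xA; rewrite /h index_cat xA nth_cat index_mem xA nth_index.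
  exists h => //; split=> //; apply/eqP; rewrite eqEfcard (card_imfset_in hi.1) ?fsubsetUr // cij leqnn andbT.
  apply/fsubsetP=> _ /imfsetP[x /= xG ->]; rewrite /h index_cat.
  case: ifP => xA; first by have := fdisjointP di x xA; rewrite xG.
  by rewrite nth_cat ltnNge leq_addr /= addKn mem_nth // -cij index_mem.
have s0 : 0 < size s' by apply: leq_ltn_trans Ms'.
pose F := base L A (G 0).
have FG i : i < size s' -> base L A (G i) = F.
  by move=> si; have [h hi [hA hG]] := isoG 0 i s0 si; apply: iso_base hi hA hG.
have FA : F `<=` A by apply/fsubsetP=> a /baseP[e _ []].
have [_ _ _ cpL] := klass_limit mu w_gt0.
have cop : copies w L F G (size s').
  split=> [i si|i si|i j si sj ij|i j si sj].
  - by rewrite -(FG i si); have [pi _ _] := GP i si; have [] := prim_base pi.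
  - by rewrite -(FG i si); have [pi _ _] := GP i si; have [] := prim_base pi.
  - have [pi ci _] := GP i si; have [pj cj _] := GP j sj.
    apply: (prim_disjoint sA pi pj ci cj) => /eqP.
    by rewrite nth_uniq // => /eqP.
  have [h hi [hA hG]] := isoG i j si sj; exists h.
    by apply: iso_sub hi _; rewrite fsetSU.
  by split=> // x /(fsubsetP FA) /hA.
have := cpL _ _ _ cop; rewrite leqNgt => /negP; apply; apply: leq_ltn_trans Ms'.
have cF : #|` F| < n.+1 by rewrite ltnS (leq_trans (fsubset_leq_card FA)).
exact: (leq_bigmax (Ordinal cF)).
Qed.

(** Membership in the dimension closure of A, as witnessed by at most m points. *)
Definition bad m A d := exists2 Z, [/\ fdisjoint A Z, d \in Z & #|` Z| <= m] &
  #|` Z| <= w * #|` newE L A Z|.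

Lemma cover_union (Q : {fset nat} -> nat -> Prop) (s : seq {fset nat}) c :
  (forall X, X \in s -> exists2 S, #|` S| <= c & forall d, Q X d -> d \in S) ->
  exists2 S, #|` S| <= size s * c & forall X d, X \in s -> Q X d -> d \in S.
Proof.
elim: s => [|X s IH] H; first by exists fset0.
have [S cS QS] := H X (mem_head _ _).
have [|S' cS' QS'] := IH; first by move=> Y Ys; apply: H; rewrite inE Ys orbT.
exists (S `|` S').
  rewrite mulSn; apply: leq_trans (leq_add cS cS'); rewrite -cardfsUI leq_addr //.
move=> Y d; rewrite !inE => /predU1P[->|Ys] QY; first by rewrite QS.
by rewrite (QS' Y) ?orbT.
Qed.

(** A witness Z starts with one of the few 0-primitive extensions, and what remains is a smaller
    witness over the enlarged set. The level q is fixed before the size n, as both [hull] and the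
    game demand. *)
Lemma bad_finite m : exists q, forall n, exists c, forall A, #|` A| <= n -> str w L q A ->
  exists2 S, #|` S| <= c & forall d, bad m A d -> d \in S.
Proof.
elim: m => [|m [q IH]].
  exists 0 => n; exists 0 => A _ _; exists fset0 => // d [Z [_ dZ]].
  by rewrite leqn0 cardfs_eq0 => /eqP Z0; rewrite Z0 in dZ.
(* Twice m + 1 for the disjointness of the extensions, and m + 1 plus q to keep A with one of them
   self-sufficient at level q. *)
exists (m.+1 + m.+1 + q) => n.
have [g gP] := prims_bounded n m.+1; have [c cP] := IH (n + m.+1).
exists (g * (m.+1 + c)) => A cA sA.
have [s sg sP] := gP A cA (str_le (leq_addr _ _) sA).
pose Q X d := prim w L A X /\ #|` X| <= m.+1 /\ (d \in X \/ bad m (A `|` X) d).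
have [X Xs|S cS SP] := @cover_union Q s (m.+1 + c).
  case: (pselect (prim w L A X /\ #|` X| <= m.+1)) => [[pX cX]|nX]; last first.
    by exists fset0 => // d [? [? _]]; case: nX.
  have [dX X0 eX _] := pX.
  have [||S cS SP] := cP (A `|` X).
  - by rewrite card_disj // leq_add.
  - apply: str_ext => //; first by rewrite eX.
    by apply: str_le sA; rewrite leq_add2r (leq_trans cX) // leq_addr.
  exists (X `|` S); last by move=> d [_ [_ [dX'|/SP dS]]]; rewrite inE ?dX' ?dS ?orbT.
  apply: leq_trans (leq_add cX cS); rewrite -cardfsUI leq_addr //.
exists S; first by apply: leq_trans cS _; rewrite leq_mul2r sg orbT.
move=> d [Z [dZ dinZ cZ] eZ].
have Z0 : Z != fset0 by apply/fset0Pn; exists d.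
have sZ : str w L #|` Z| A by apply: str_le sA; lia.
have [X XZ pX] := str_min dZ Z0 sZ eZ.
have cX : #|` X| <= m.+1 by apply: leq_trans cZ; apply: fsubset_leq_card.
apply: (SP X d); first exact: sP.
split=> //; split=> //; case: (boolP (d \in X)) => dX; [by left|right].
have [dAX X0 eX _] := pX.
have ZX : X `|` (Z `\` X) = Z by fset_tac.
have dXR : fdisjoint X (Z `\` X) by fset_tac.
have dd : fdisjoint (A `|` X) (Z `\` X) by fset_tac.
have cs := card_disj dXR; rewrite ZX in cs.
have X1 : 0 < #|` X| by rewrite cardfs_gt0.
exists (Z `\` X); first by split; rewrite ?inE ?dX //; lia.
have eqn := card_newE_split L dd; rewrite ZX in eqn.
by move: eZ; rewrite eqn cs mulnDr -eX leq_add2l.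
Qed.

(** Each failure of self-sufficiency adds at most m points and lowers the dimension, here bounded by
    d, by at least 1; it starts at no more than the size of P and never becomes negative. *)
Lemma hull m (P : {fset nat}) : exists2 A, P `<=` A &
  str w L m A /\ #|` A| <= #|` P| + m * #|` P|.
Proof.
have [_ _ pos _] := klass_limit mu w_gt0.
suff H d : forall P, #|` P| <= w * #|` newE L fset0 P| + d ->
    exists2 A, P `<=` A & str w L m A /\ #|` A| <= #|` P| + m * d.
  by apply: H; rewrite leq_addl.
elim: d => [|d IH] {}P cP.
  exists P => //; split; last by rewrite muln0 addn0.
  move=> Z dZ _; have dPZ : fdisjoint (fset0 `|` P) Z by rewrite fset0U.
  have := pos (P `|` Z); rewrite card_newE_split // fset0U mulnDr card_disj //.
  rewrite addn0 in cP => le.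
  by rewrite -(leq_add2l (w * #|` newE L fset0 P|)) (leq_trans le) // leq_add2r.
case: (pselect (str w L m P)) => [sP|]; first by exists P => //; split; rewrite ?leq_addr.
move=> /existsNP[Z] /not_implyP[dZ] /not_implyP[cZ] /negP; rewrite -ltnNge => lt.
have dPZ : fdisjoint (fset0 `|` P) Z by rewrite fset0U.
have [|A PA [sA cA]] := IH (P `|` Z).
  rewrite card_newE_split // fset0U mulnDr card_disj //; lia.
exists A; first by apply: fsubset_trans PA; apply: fsubsetUl.
split=> //; apply: leq_trans cA _; rewrite card_disj // mulnS; lia.
Qed.

End Finiteness.

(** * Strong minimality *)

Section Minimality.
Variables (w : nat) (mu : nat -> nat).
Hypothesis w_gt0 : 0 < w.
Hypothesis mu_ge : forall p, p + 2 <= mu p.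
Implicit Types (E : {fset nat} -> bool) (A B F X Y Z S e : {fset nat}).
Implicit Types (G : nat -> {fset nat}) (h : nat -> nat).

Notation L := (limit w mu).

Definition space E : structure := @Structure nat (fun x y z =>
  [/\ x <> y, x <> z, y <> z & exists2 e, E e & [&& x \in e, y \in e & z \in e]]).

Lemma disj1 A c : c \notin A -> fdisjoint A [fset c].
Proof. by move=> cA; apply/fdisjointP=> x xA; rewrite inE; apply: contraNneq cA => <-. Qed.

Lemma generic_str A c m : c \notin A -> ~ bad w mu m.+1 A c ->
  str w L m (A `|` [fset c]) /\ newE L A [fset c] = fset0.
Proof.
move=> cA nb; have dAc := disj1 cA.
have H Z : fdisjoint A Z -> c \in Z -> #|` Z| <= m.+1 -> w * #|` newE L A Z| < #|` Z|.
  by move=> dZ cZ mZ; rewrite ltnNge; apply/negP => le; apply: nb; exists Z.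
split=> [Y dY cY|].
  have dcY : fdisjoint [fset c] Y by fset_tac.
  have := H ([fset c] `|` Y); rewrite card_disj // cardfs1 add1n card_newE_split // mulnDr !ltnS.
  move=> /(_ _ _ _)/(leq_trans (leq_addl _ _)); apply=> //; first by fset_tac.
  by rewrite !inE eqxx.
have := H [fset c] dAc (fset11 c); rewrite cardfs1 => /(_ isT).
rewrite ltnS leqn0 muln_eq0 => /orP[/eqP w0|/eqP/cardfs0_eq//].
by move: w_gt0; rewrite w0.
Qed.

Lemma extend_generic A h c d m : c \notin A -> d \notin h @` A ->
  ~ bad w mu m.+1 A c -> ~ bad w mu m.+1 (h @` A) d -> iso L L h A ->
  exists g, [/\ iso L L g (A `|` [fset c]), {in A, g =1 h}, g c = d &
    str w L m (A `|` [fset c]) /\ str w L m (g @` (A `|` [fset c]))].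
Proof.
move=> cA dB nc nd hA; have [sc ec] := generic_str cA nc; have [sd ed] := generic_str dB nd.
have jc : join A h (fun=> d) c = d by rewrite /join (negbTE cA).
have jA : {in A, join A h (fun=> d) =1 h} by move=> x xA; rewrite /join xA.
have jim : join A h (fun=> d) @` (A `|` [fset c]) = h @` A `|` [fset d].
  by rewrite imfsetU imfset_fset1 jc; congr (_ `|` _); apply: eq_in_imfset => x /jA.
have im1 : (fun=> d) @` [fset c] = [fset d] by rewrite imfset_fset1.
exists (join A h (fun=> d)); split=> //; last by rewrite jim.
apply: iso_join => //.
- by move=> x y /fset1P-> /fset1P->.
- by rewrite im1; exact: disj1.
move=> e eAc ec'; apply/idP/idP => Le; exfalso.
  have : e \in newE L A [fset c] by rewrite in_newE eAc Le.
  by rewrite ec.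
have : join A h (fun=> d) @` e \in newE L (h @` A) [fset d].
  rewrite in_newE Le -jim imfsetS //=; case/meetP: ec' => x xe /fset1P xc.
  by apply/meetP; exists (join A h (fun=> d) x); rewrite ?in_imfset // xc jc fset11.
by rewrite ed.
Qed.

Lemma card_gt2 (T : choiceType) (A : {fset T}) x y z : x != y -> x != z -> y != z ->
  x \in A -> y \in A -> z \in A -> 2 < #|` A|.
Proof.
move=> xy xz yz xA yA zA; have <- : #|` x |` (y |` [fset z])| = 3.
  by rewrite !cardfsU1 !inE negb_or xy xz yz cardfs1.
by apply/fsubset_leq_card/fsubsetP=> t; rewrite !inE => /or3P[]/eqP->.
Qed.

(** By [str_block] the block on three collinear points of A lies inside A, where h preserves it. *)
Lemma coll_iso A h x y z : iso L L h A -> str w L w A -> x \in A -> y \in A -> z \in A ->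
  coll (s := space L) x y z -> coll (s := space L) (h x) (h y) (h z).
Proof.
move=> hA sA xA yA zA [/eqP xy /eqP xz /eqP yz [e Le /and3P[xe ye ze]]].
have eA : e `<=` A.
  by apply: (str_block w_gt0 (leqnn w) sA Le); apply: (card_gt2 xy xz yz); rewrite inE ?xe ?ye ?ze.
split; first by move/(hA.1 _ _ xA yA)/eqP; rewrite (negbTE xy).
- by move/(hA.1 _ _ xA zA)/eqP; rewrite (negbTE xz).
- by move/(hA.1 _ _ yA zA)/eqP; rewrite (negbTE yz).
by exists (h @` e); rewrite -?hA.2 // !in_imfset.
Qed.

(* The bound m does not depend on the size of A, since the extensions used in the
   game are controlled by their number of new points. *)
Lemma back_and_forth n (f : formula n) : exists m, forall A h (u : 'I_n -> nat),
  (forall i, u i \in A) -> iso L L h A -> str w L m A -> str w L m (h @` A) ->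
  (sat (M := space L) f u <-> sat (M := space L) f (h \o u)).
Proof.
(* The hypotheses are symmetric under inverting h, so one implication suffices. *)
have flip k (g : formula k) m : (forall A h (u : 'I_k -> nat),
    (forall i, u i \in A) -> iso L L h A -> str w L m A -> str w L m (h @` A) ->
    sat (M := space L) g u -> sat (M := space L) g (h \o u)) ->
  forall A h (u : 'I_k -> nat),
    (forall i, u i \in A) -> iso L L h A -> str w L m A -> str w L m (h @` A) ->
    (sat (M := space L) g u <-> sat (M := space L) g (h \o u)).
  move=> H A h u uA hA sA sB; split; first exact: H hA sA sB.
  have [q qK] := imfset_linv hA.1.
  move=> S; have -> : u = q \o (h \o u) by apply: funext => i /=; rewrite qK.
  apply: (H (h @` A) q) S => [i||//|].
  - by rewrite /= in_imfset.
  - exact: iso_inv hA qK.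
  - by rewrite (imfset_lcan qK) ?fsubset_refl.
elim: f => {n} [n i j|n i j k|n g [m IH]|n g1 [m1 IH1] g2 [m2 IH2]|n g [m IH]].
- exists 0; apply: flip => A h u uA hA _ _ /= eqij; by rewrite eqij.
- by exists w; apply: flip => A h u uA hA sA _; exact: (coll_iso hA sA (uA i) (uA j) (uA k)).
- by exists m => A h u uA hA sA sB /=; rewrite (IH A h u).
- exists (m1 + m2) => A h u uA hA sA sB /=.
  have [le1 le2] := (leq_addr m2 m1, leq_addl m1 m2).
  rewrite (IH1 A h u uA hA (str_le le1 sA) (str_le le1 sB)).
  by rewrite (IH2 A h u uA hA (str_le le2 sA) (str_le le2 sB)).
have [q qP] := bad_finite mu w_gt0 m.+1.
(* The level pays for a set of at most m + 1 points around the new point, for the level m that must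
   survive, and for the finiteness of the bad points over the image. *)
exists (m.+1 + m + q); apply: flip => A h u uA hA sA sB [a Sa].
have step A' h' : a \in A' -> A `<=` A' -> {in A, h' =1 h} -> iso L L h' A' ->
    str w L m A' -> str w L m (h' @` A') -> sat (M := space L) (FEx g) (h \o u).
  move=> aA' AA' hh hA' sA' sB'; exists (h' a).
  have -> : scons (h' a) (h \o u) = h' \o scons a u.
    by rewrite scons_comp; congr (scons _ _); apply: funext => i /=; rewrite hh.
  have us i : scons a u i \in A'.
    by rewrite /scons; case: unlift => // j; apply: (fsubsetP AA'); exact: uA.
  by rewrite -(IH A' h' _ us hA' sA' sB').
have lem : m <= m.+1 + m + q by lia.
case: (boolP (a \in A)) => aA.
  by apply: (step A h) => //; [exact: str_le sA | exact: str_le sB].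
case: (pselect (bad w mu m.+1 A a)) => [[Z [dZ aZ cZ] eZ]|nb].
  have le1 : #|` Z| + m <= m.+1 + m + q by lia.
  have le2 : #|` Z| <= m.+1 + m + q by lia.
  have [h' hi' hh] := extend w_gt0 mu_ge dZ eZ (str_le le2 sA) hA (str_le le2 sB).
  have hA' : h' @` A = h @` A by apply: eq_in_imfset => x /hh.
  apply: (step (A `|` Z) h') => //.
  - by rewrite inE aZ orbT.
  - exact: fsubsetUl.
  - by apply: str_ext => //; exact: str_le sA.
  have cZ' : #|` h' @` Z| = #|` Z| by rewrite (card_imfset_in hi'.1) ?fsubsetUr.
  have dB : fdisjoint (h @` A) (h' @` Z).
    by rewrite -[in X in fdisjoint X]hA' (imfset_disj_in hi'.1) ?fsubsetUl ?fsubsetUr.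
  have eB : #|` h' @` Z| <= w * #|` newE L (h @` A) (h' @` Z)|.
    by rewrite cZ' (iso_newE_eq hi' hA' erefl).
  by rewrite imfsetU hA'; apply: (str_ext w_gt0 dB eB); rewrite cZ'; exact: str_le sB.
have [c cP] := qP #|` h @` A|.
have [|S _ SP] := cP (h @` A) (leqnn _); first by apply: str_le sB; rewrite leq_addl.
have [d dP] := below_ex (S `|` h @` A).
have dN : d \notin S `|` h @` A by apply/negP => /dP; rewrite ltnn.
move: dN; rewrite inE negb_or => /andP[dS dB].
have [|h' [hi' hh hc [sA' sB']]] := extend_generic aA dB nb _ hA.
  by move=> /SP; rewrite (negbTE dS).
apply: (step (A `|` [fset a]) h') => //; last exact: fsubsetUl.
by rewrite !inE eqxx orbT.
Qed.

(** Over a hull A of the parameters, any two points outside A that are not bad are exchanged by a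
    partial isomorphism fixing A. *)
Lemma generic_type n (f : formula n.+1) : exists c, forall p : 'I_n -> nat,
  exists2 S, #|` S| <= c & forall d d', d \notin S -> d' \notin S ->
    sat (M := space L) f (scons d p) -> sat (M := space L) f (scons d' p).
Proof.
have [m mP] := back_and_forth f.
have [q qP] := bad_finite mu w_gt0 m.+1.
have [c cP] := qP (n + q * n); exists (c + (n + q * n)) => p.
pose P := [fset x in [seq p i | i <- enum 'I_n]].
have pP i : p i \in P by rewrite inE /= map_f // mem_enum.
have cn : #|` P| <= n.
  by rewrite card_fseq (leq_trans (size_undup _)) // size_map size_enum_ord.
have [A PA [sA cA]] := hull mu w_gt0 q P.
have cA' : #|` A| <= n + q * n by apply: leq_trans cA _; rewrite leq_add // leq_mul2l cn orbT.
have [S cS SP] := cP A cA' sA.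
exists (S `|` A).
  by apply: leq_trans (leq_add cS cA'); rewrite -cardfsUI leq_addr.
move=> d d'; rewrite !in_fsetU !negb_or => /andP[dS dA] /andP[dS' dA'] Sd.
have hid : iso L L id A by split=> // e _; rewrite imfset_id.
have nb : ~ bad w mu m.+1 A d by move/SP; rewrite (negbTE dS).
have [||h [hi hh hd [s1 s2]]] := @extend_generic A id d d' m dA _ nb _ hid; rewrite ?imfset_id //.
  by move/SP; rewrite (negbTE dS').
have -> : scons d' p = h \o scons d p.
  rewrite scons_comp hd; congr (scons _ _); apply: funext => i /=; rewrite hh //.
  exact: (fsubsetP PA).
have us i : scons d p i \in A `|` [fset d].
  rewrite /scons inE; case: unlift => [j|]; last by rewrite fset11 orbT.
  by rewrite (fsubsetP PA).
by rewrite -(mP _ _ _ us hi s1 s2).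
Qed.

Lemma space_strongly_minimal : strongly_minimal (space L).
Proof.
apply: strongly_minimal_of_uniform => [|n f]; first exact: infinite_nat.
have [c cP] := generic_type f; exists c.+1 => p [/sat_at_least[x xi xf] /sat_at_least[y yi yf]].
have [S cS SP] := cP p.
have out (z : 'I_c.+1 -> nat) : injective z -> exists i, z i \notin S.
  move=> zi; apply: contrapT => nex.
  have sub : [fset t in [seq z i | i <- enum 'I_c.+1]] `<=` S.
    apply/fsubsetP=> t; rewrite inE /= => /mapP[i _ ->]; apply: contraT => ?.
    by case: nex; exists i.
  have := fsubset_leq_card sub; rewrite card_fseq undup_id; last by rewrite map_inj_uniq ?enum_uniq.
  by rewrite size_map size_enum_ord ltnNge cS.
have [i xS] := out x xi; have [j yS] := out y yi.
exact: (yf j) (SP _ _ xS yS (xf i)).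
Qed.

End Minimality.

(** * Lines and theories of the generic structures *)

Section Steiner.
Variables (w : nat) (mu : nat -> nat).
Hypothesis w_gt0 : 0 < w.
Hypothesis mu_ge : forall p, p + 2 <= mu p.
Implicit Types (E : {fset nat} -> bool) (A B F X Y Z S e : {fset nat}).
Implicit Types (G : nat -> {fset nat}) (h : nat -> nat).

Notation L := (limit w mu).

Lemma space_linear : linear_space (space L).
Proof.
split=> [x y z [? ? ?]|x y z [xy xz yz [e Le /and3P[xe ye ze]]]|x y z t] //.
  by split; split; try exact: nesym; rewrite //; exists e; rewrite // ?xe ?ye ?ze.
move=> [xy xz yz [e Le /and3P[xe ye ze]]] [_ xt yt [e' Le' /and3P[xe' ye' te']]] zt.
split=> //; first exact: nesym.
have ee : e = e'.
  apply: (L_linear w_gt0 Le Le'); apply/cardfs_gt1P; exists x, y.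
  by split; [apply/negP => /eqP|rewrite inE xe|rewrite inE ye].
by exists e; rewrite // xe ze ee te'.
Qed.

Lemma steiner_space : steiner w.+2 (@lines (space L)).
Proof.
exists nat; apply: (lines_pbd space_linear) => [k ->//|a b ab]; exists w.+2 => //.
have /eqP nab := ab; have [e Le /andP[ae be]] := pair_block w_gt0 mu_ge nab.
suff -> : line (M := space L) a b = [set` e]%classic.
  by apply/card_eq_fsetP; exact: (L_size w_gt0 Le).
apply/seteqP; split=> x /=.
  case=> [->//|->//|[_ _ _ [e' Le' /and3P[ae' be' xe']]]].
  suff -> : e = e' by [].
  apply: (L_linear w_gt0 Le Le'); apply/cardfs_gt1P; exists a, b.
  by split; rewrite ?inE ?ae ?be.
move=> xe; have [->|/eqP xa] := eqVneq x a; first by constructor 1.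
have [->|/eqP xb] := eqVneq x b; first by constructor 2.
constructor 3; split=> //; try exact: nesym.
by exists e; rewrite // ae be.
Qed.

(** Recovers blocks from collinearity, which is all that a theory sees. *)
Lemma block_coll e : L e <-> #|` e| = w.+2 /\
  forall x y z, x \in e -> y \in e -> z \in e -> x <> y -> x <> z -> y <> z ->
    coll (s := space L) x y z.
Proof.
split=> [Le|[ce cl]].
  split=> [|x y z xe ye ze xy xz yz]; first exact: (L_size w_gt0 Le).
  by split=> //; exists e; rewrite // xe ye.
have /cardfs_gt1P[a [b [ab ae be]]] : 1 < #|` e| by rewrite ce.
have [e' Le' /andP[ae' be']] := pair_block w_gt0 mu_ge ab.
suff ee : e `<=` e'.
  suff -> : e = e' by [].
  by apply/eqP; rewrite eqEfcard ee ce (L_size w_gt0 Le') leqnn.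
apply/fsubsetP=> x xe; have [->//|/eqP xa] := eqVneq x a.
have [->//|/eqP xb] := eqVneq x b.
have [_ _ _ [e2 Le2 /and3P[a2 b2 x2]]] := cl a b x ae be xe (elimN eqP ab) (nesym xa) (nesym xb).
suff <- : e2 = e' by [].
apply: (L_linear w_gt0 Le2 Le'); apply/cardfs_gt1P; exists a, b.
by split; rewrite ?inE ?a2 ?b2.
Qed.

(** Generic points are added one by one, each without any new block. The level m varies in the
    induction because each addition demands a higher one beforehand. *)
Lemma independent_set l m : exists B, [/\ #|` B| = l, str w L m B &
  forall e, e `<=` B -> ~~ L e].
Proof.
elim: l m => [|l IH] m.
  exists fset0; split; first exact: cardfs0.
    by move=> Z _ _; have [_ _ pos _] := klass_limit mu w_gt0; exact: pos.
  by move=> e; rewrite fsubset0 => /eqP->; apply/negP => /(L_size w_gt0); rewrite cardfs0.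
have [q qP] := bad_finite mu w_gt0 m.+1; have [B [cB sB nB]] := IH q.
have [c cP] := qP #|` B|; have [S _ SP] := cP B (leqnn _) sB.
have [d dP] := below_ex (S `|` B).
have dN : d \notin S `|` B by apply/negP => /dP; rewrite ltnn.
move: dN; rewrite inE negb_or => /andP[dS dB].
have nb : ~ bad w mu m.+1 B d by move/SP; rewrite (negbTE dS).
have [sd ed] := generic_str w_gt0 dB nb.
exists (B `|` [fset d]); split=> //.
  by rewrite card_disj ?cardfs1 ?cB ?addn1 //; exact: disj1.
move=> e es; apply/negP => Le; case: (boolP (fdisjoint e [fset d])) => ed'.
  have : e `<=` B.
    apply/fsubsetP=> x xe; have := fsubsetP es x xe; rewrite inE => /orP[//|xd].
    by have := fdisjointP ed' x xe; rewrite xd.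
  by move/nB; rewrite Le.
have : e \in newE L B [fset d] by rewrite in_newE es Le.
by rewrite ed.
Qed.

End Steiner.

(** * Transfer of copies between elementarily equivalent structures *)

Section Theory.
Variables (w : nat) (mu1 mu2 : nat -> nat).
Hypothesis w_gt0 : 0 < w.
Hypotheses (mu1_ge : forall p, p + 2 <= mu1 p) (mu2_ge : forall p, p + 2 <= mu2 p).

Lemma theory_iso (H : {fset nat}) :
  theory (space (limit w mu1)) = theory (space (limit w mu2)) ->
  exists h, iso (limit w mu1) (limit w mu2) h H.
Proof.
move=> th; pose u (i : 'I_#|` H|) : space (limit w mu1) := nth 0 H i.
have [v [veq vcoll]] := theory_diagram u th.
pose h x : nat := if insub (index x H) is Some i then v i else 0.
have hP x : x \in H -> exists i, u i = x /\ h x = v i.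
  move=> xH; have lt : index x H < #|` H| by rewrite index_mem.
  by exists (Ordinal lt); rewrite /u /= nth_index // /h insubT.
have hi : {in H &, injective h}.
  by move=> x y /hP[i [<- ->]] /hP[j [<- ->]] /veq.
exists h; split=> // e eH.
have ce : #|` h @` e| = #|` e| by rewrite (card_imfset_in hi).
have eP x : x \in e -> exists i, u i = x /\ h x = v i by move=> /(fsubsetP eH)/hP.
apply/idP/idP.
  move=> /(block_coll w_gt0 mu1_ge)[se cl]; apply/(block_coll w_gt0 mu2_ge).
  split; first by rewrite ce.
  move=> _ _ _ /imfsetP[x /= xe ->] /imfsetP[y /= ye ->] /imfsetP[z /= ze ->] xy xz yz.
  have [i [ui ei]] := eP x xe; have [j [uj ej]] := eP y ye; have [k [uk ek]] := eP z ze.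
  rewrite ei ej ek in xy xz yz *; have := cl x y z xe ye ze; rewrite -ui -uj -uk => H1.
  by apply/vcoll; apply: H1 => /veq.
move=> /(block_coll w_gt0 mu2_ge)[se cl]; apply/(block_coll w_gt0 mu1_ge).
split=> [|x y z xe ye ze xy xz yz]; first by rewrite -ce.
have := cl (h x) (h y) (h z); rewrite !in_imfset // => /(_ isT isT isT) => H1.
have [i [ui ei]] := eP x xe; have [j [uj ej]] := eP y ye; have [k [uk ek]] := eP z ze.
rewrite -ui -uj -uk; apply/vcoll; rewrite -ei -ej -ek; apply: H1.
- by move=> /hi exy; apply: xy; apply: exy; apply: (fsubsetP eH).
- by move=> /hi exy; apply: xz; apply: exy; apply: (fsubsetP eH).
- by move=> /hi exy; apply: yz; apply: exy; apply: (fsubsetP eH).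
Qed.

Lemma theory_copies F G r : theory (space (limit w mu1)) = theory (space (limit w mu2)) ->
  copies w (limit w mu1) F G r -> r <= mu2 #|` F|.
Proof.
move=> th cop; pose S := F `|` (\bigcup_(i <- iota 0 r) G i)%fset.
have [h hi] := theory_iso S th.
have FS : F `<=` S by exact: fsubsetUl.
have GS i : i < r -> G i `<=` S.
  move=> ir; apply: fsubset_trans (fsubsetUr _ _).
  by apply: bigfcup_sup; rewrite ?mem_iota.
have [_ _ _ cp] := klass_limit mu2 w_gt0.
by have := cp _ _ _ (copies_iso hi FS GS cop); rewrite (card_imfset_in hi.1).
Qed.

End Theory.

(** * A cycle of blocks *)

Section Cycle.
Variables w l : nat.
Hypotheses (w_gt0 : 0 < w) (l_gt2 : 2 < l).

Definition cyc_succ t := t.+1 %% l.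

Definition cyc_new : {fset nat} := [fset x in iota 0 (l * w)].
Definition cyc_old : {fset nat} := [fset x in iota (l * w) l].

(* The block t consists of the w.+1 consecutive residues modulo l * w starting
   at t * w, and of one old point of its own. *)
Definition cyc_block t : {fset nat} :=
  [fset x in iota 0 (l * w + l) |
    [|| x %/ w == t, x == cyc_succ t * w | x == l * w + t]].

Definition cyc e := [exists t : 'I_l, e == cyc_block t].

Lemma cyc_succE t : t < l -> cyc_succ t = if t.+1 == l then 0 else t.+1.
Proof.
move=> tl; rewrite /cyc_succ; case: eqP => [->|ne]; first exact: modnn.
by rewrite modn_small //; lia.
Qed.

Lemma cyc_succ_lt t : cyc_succ t < l.
Proof. by rewrite ltn_mod; lia. Qed.

Lemma in_new x : (x \in cyc_new) = (x < l * w).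
Proof. by rewrite !inE /= mem_iota. Qed.

Lemma in_old x : (x \in cyc_old) = (l * w <= x < l * w + l).
Proof. by rewrite !inE /= mem_iota. Qed.

Lemma divw_lt x t : x %/ w = t -> t < l -> x < l * w.
Proof. by move=> <-; rewrite ltn_divLR. Qed.

Lemma succ_lt t : cyc_succ t * w < l * w.
Proof. by rewrite ltn_pmul2r // cyc_succ_lt. Qed.

Lemma in_block t x : t < l ->
  (x \in cyc_block t) = [|| x %/ w == t, x == cyc_succ t * w | x == l * w + t].
Proof.
move=> tl; rewrite !inE /= mem_iota /= add0n andb_idl // => /or3P[/eqP e|/eqP ->|/eqP ->].
- by apply: ltn_addr; apply: divw_lt e tl.
- by apply: ltn_addr; exact: succ_lt.
- by rewrite ltn_add2l.
Qed.

Lemma cycP e : reflect (exists2 t, t < l & e = cyc_block t) (cyc e).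
Proof.
apply: (iffP existsP) => [[t /eqP->]|[t tl ->]]; first by exists t.
by exists (Ordinal tl).
Qed.

Lemma disj_cyc : fdisjoint cyc_old cyc_new.
Proof. by apply/fdisjointP=> x; rewrite in_old in_new -leqNgt => /andP[]. Qed.

Lemma card_new : #|` cyc_new| = l * w.
Proof. by rewrite card_fseq undup_id ?iota_uniq // size_iota. Qed.

Lemma card_old : #|` cyc_old| = l.
Proof. by rewrite card_fseq undup_id ?iota_uniq // size_iota. Qed.

Lemma block_sub t : t < l -> cyc_block t `<=` cyc_old `|` cyc_new.
Proof.
move=> tl; apply/fsubsetP=> x; rewrite in_block // inE in_old in_new.
move=> /or3P[/eqP e|/eqP ->|/eqP ->].
- by rewrite (divw_lt e tl) orbT.
- by rewrite succ_lt orbT.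
- by rewrite leq_addr ltn_add2l tl.
Qed.

Lemma block_old t a : t < l -> a \in cyc_old -> (a \in cyc_block t) = (a == l * w + t).
Proof.
move=> tl; rewrite in_old in_block // => /andP[la _].
case: eqP => [e|_] /=; first by have := divw_lt e tl; rewrite ltnNge la.
by case: eqP => [e|//]; have := succ_lt t; rewrite -e ltnNge la.
Qed.

Lemma block_new t x : t < l -> x \in cyc_new -> x \in cyc_block t ->
  t = x %/ w \/ cyc_succ t = x %/ w.
Proof.
move=> tl; rewrite in_new in_block // => lx /or3P[/eqP->|/eqP->|/eqP e]; first by left.
  by right; rewrite mulnK.
by move: lx; rewrite e ltnNge leq_addr.
Qed.

Lemma block_start t : t < l -> t * w \in cyc_block t.
Proof. by move=> tl; rewrite in_block // mulnK // eqxx. Qed.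

Lemma block_inj t t' : t < l -> t' < l -> cyc_block t = cyc_block t' -> t = t'.
Proof.
move=> tl tl' eqb; have : l * w + t \in cyc_block t by rewrite in_block // eqxx !orbT.
rewrite eqb block_old // ?in_old ?leq_addr ?ltn_add2l //.
by rewrite eqn_add2l => /eqP.
Qed.

Lemma card_block t : t < l -> #|` cyc_block t| = w.+2.
Proof.
move=> tl; pose R := (addn (t * w)) @` [fset i in iota 0 w].
have inR x : (x \in R) = (x %/ w == t).
  apply/imfsetP/eqP => [[i /= ]|e].
    rewrite !inE /= mem_iota => iw ->; rewrite divnMDl // divn_small ?addn0 //.
  exists (x %% w); last by rewrite -e -divn_eq.
  by rewrite !inE /= mem_iota ltn_mod.
have cR : #|` R| = w.
  by rewrite card_imfset /= ?card_fseq ?undup_id ?iota_uniq ?size_iota //; exact: addnI.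
have -> : cyc_block t = R `|` [fset cyc_succ t * w; l * w + t].
  by apply/fsetP=> x; rewrite in_block // in_fsetU inR !inE.
rewrite card_disj ?cR ?cardfs2; last first.
  apply/fdisjointP=> x; rewrite inR !inE => /eqP xt; apply/norP; split; apply/eqP => e.
    move: xt; rewrite e mulnK // cyc_succE //; case: eqP; lia.
  by have := divw_lt xt tl; rewrite e ltnNge leq_addr.
have -> : cyc_succ t * w != l * w + t.
  by apply/eqP => e; have := succ_lt t; rewrite e ltnNge leq_addr.
by rewrite addn2.
Qed.

Lemma block_common t t' x : t < l -> t' < l -> t <> t' ->
  x \in cyc_block t -> x \in cyc_block t' ->
  (t = cyc_succ t' /\ x = t * w) \/ (t' = cyc_succ t /\ x = t' * w).
Proof.
move=> tl tl' ne xt xt'; have := fsubsetP (block_sub tl) x xt.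
rewrite inE => /orP[xo|xn].
  move: xt xt'; rewrite !block_old // => /eqP-> /eqP/addnI.
  by move=> e; case: ne.
have xnl : x <> l * w + t by move: xn; rewrite in_new => lt e; move: lt; rewrite e; lia.
have xnl' : x <> l * w + t' by move: xn; rewrite in_new => lt e; move: lt; rewrite e; lia.
move: xt xt'; rewrite !in_block // => /or3P[/eqP e|/eqP e|/eqP//] /or3P[/eqP e'|/eqP e'|/eqP//].
- by case: ne; rewrite -e -e'.
- have es : t = cyc_succ t' by rewrite -e e' mulnK.
  by left; split=> //; rewrite es.
- have es : t' = cyc_succ t by rewrite -e' e mulnK.
  by right; split=> //; rewrite es.
case: ne; move: e'; rewrite e => /eqP; rewrite eqn_pmul2r // !cyc_succE //.
by case: (t.+1 =P l) => ?; case: (t'.+1 =P l) => ? /eqP; lia.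
Qed.

(** Distinct blocks meet only at the start of one that succeeds the other; for l > 2 two blocks
    cannot succeed each other mutually. *)
Lemma cyc_linear e1 e2 : cyc e1 -> cyc e2 -> 1 < #|` e1 `&` e2| -> e1 = e2.
Proof.
move=> /cycP[t tl ->] /cycP[t' tl' ->] /cardfs_gt1P[x [y [xy]]].
rewrite !in_fsetI => /andP[xt xt'] /andP[yt yt'].
case: (t =P t') => [->//|ne]; exfalso.
have [[s1 ex]|[s1 ex]] := block_common tl tl' ne xt xt';
  have [[s2 ey]|[s2 ey]] := block_common tl tl' ne yt yt'.
- by move: xy; rewrite ex ey eqxx.
- by move: s1 s2; rewrite !cyc_succE //; case: (t.+1 =P l) => ?; case: (t'.+1 =P l) => ?; lia.
- by move: s1 s2; rewrite !cyc_succE //; case: (t.+1 =P l) => ?; case: (t'.+1 =P l) => ?; lia.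
- by move: xy; rewrite ex ey eqxx.
Qed.

Lemma newE_cyc : newE cyc cyc_old cyc_new = cyc_block @` [fset t in iota 0 l].
Proof.
apply/fsetP=> e; rewrite in_newE; apply/and3P/imfsetP => [[_ /cycP[t tl ->] _]|[t /=]].
  by exists t; rewrite // !inE /= mem_iota.
rewrite !inE /= mem_iota => tl ->; split; first exact: block_sub.
  by apply/cycP; exists t.
apply/meetP; exists (t * w); first exact: block_start.
by rewrite in_new ltn_pmul2r.
Qed.

Lemma card_newE_cyc : #|` newE cyc cyc_old cyc_new| = l.
Proof.
rewrite newE_cyc card_in_imfset /=; first by rewrite card_fseq undup_id ?iota_uniq ?size_iota.
by move=> t t'; rewrite !inE /= !mem_iota; exact: block_inj.
Qed.

Lemma card_ranges (T : {fset nat}) :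
  #|` [fset x in [seq t * w + j | t <- T, j <- iota 0 w]]| = #|` T| * w.
Proof.
rewrite card_fseq undup_id ?size_allpairs ?size_iota //.
apply: allpairs_uniq; rewrite ?fset_uniq ?iota_uniq // => -[t j] [t' j'].
move=> /allpairsP[[t1 j1] [_ /= j1w [-> ->]]] /allpairsP[[t2 j2] [_ /= j2w [-> ->]]] /= eqx.
move: j1w j2w; rewrite !mem_iota /= !add0n => j1w j2w.
have et : t1 = t2 by have := congr1 (divn^~ w) eqx; rewrite !divnMDl // !divn_small // !addn0.
by move: eqx; rewrite et => /addnI ->.
Qed.

(** Each block inside the old points and Y puts its own w consecutive points R into Y. If these
    exhausted Y, the set T of such blocks would be closed under successor, hence contain the whole
    cycle. *)
Lemma prim_cyc : prim w cyc cyc_old cyc_new.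
Proof.
split; first exact: disj_cyc.
- by rewrite -cardfs_gt0 card_new muln_gt0 w_gt0 andbT; lia.
- by rewrite card_newE_cyc card_new mulnC.
move=> Y YX Y0 nYX.
pose T := [fset t in iota 0 l | cyc_block t `<=` cyc_old `|` Y].
have TP t : (t \in T) = (t < l) && (cyc_block t `<=` cyc_old `|` Y).
  by rewrite !inE /= mem_iota.
have sub : newE cyc cyc_old Y `<=` cyc_block @` T.
  apply/fsubsetP=> e; rewrite in_newE => /and3P[es /cycP[t tl et] _].
  by apply/imfsetP; exists t => //=; rewrite TP tl -et.
have le : #|` newE cyc cyc_old Y| <= #|` T|.
  exact: leq_trans (fsubset_leq_card sub) (leq_imfset_card _ _ _).
pose R := [fset x in [seq t * w + j | t <- T, j <- iota 0 w]].
have RP x : (x \in R) = (x %/ w \in T).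
  rewrite inE /=; apply/allpairsP/idP => [[[t j] /= [tT]]|xT].
    by rewrite mem_iota /= add0n => jw ->; rewrite divnMDl // divn_small // addn0.
  by exists (x %/ w, x %% w); rewrite /= mem_iota ltn_mod w_gt0 -divn_eq.
have inY t x : t \in T -> x \in cyc_new -> x \in cyc_block t -> x \in Y.
  rewrite TP => /andP[_ tY] xn xb; have := fsubsetP tY x xb.
  by rewrite inE => /orP[xo|//]; have := fdisjointP disj_cyc x xo; rewrite xn.
have RY : R `<=` Y.
  apply/fsubsetP=> x; rewrite RP => xT; have := xT; rewrite TP => /andP[tl _].
  by apply: (inY _ _ xT); rewrite ?in_new ?(divw_lt erefl tl) // in_block // eqxx.
have neR : R != Y.
  apply/eqP => eqR; have /fset0Pn[x xY] := Y0.
  have succT t : t \in T -> cyc_succ t \in T.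
    move=> tT; have := tT; rewrite TP => /andP[tl _].
    have : cyc_succ t * w \in Y.
      by apply: (inY t) => //; rewrite ?in_new ?succ_lt // in_block // eqxx orbT.
    by rewrite -eqR RP mulnK.
  have t0T : x %/ w \in T by rewrite -RP eqR.
  have t0l : x %/ w < l by move: t0T; rewrite TP => /andP[].
  have addT n : (x %/ w + n) %% l \in T.
    elim: n => [|n IH]; first by rewrite addn0 modn_small.
    by have := succT _ IH; rewrite /cyc_succ -addn1 modnDml addn1 addnS.
  move/negP: nYX; apply; rewrite eqEfsubset YX /=.
  apply/fsubsetP=> y; rewrite in_new -eqR RP => ylt.
  have yl : y %/ w < l by rewrite ltn_divLR.
  have := addT (y %/ w + (l - x %/ w)).
  suff -> : (x %/ w + (y %/ w + (l - x %/ w))) %% l = y %/ w by [].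
  by rewrite addnCA subnKC ?(ltnW t0l) // modnDr modn_small.
apply: (@leq_ltn_trans (#|` T| * w)); first by rewrite mulnC leq_mul2r le orbT.
by rewrite -card_ranges; apply: fproper_ltn_card; rewrite fproperEneq neR.
Qed.

Lemma based_cyc : based cyc cyc_old cyc_new.
Proof.
move=> a ao; have := ao; rewrite in_old => /andP[la al].
have tl : a - l * w < l by rewrite ltn_subLR.
exists (cyc_block (a - l * w)); last by rewrite block_old // subnKC.
by rewrite newE_cyc; apply/imfsetP; exists (a - l * w); rewrite //= !inE /= mem_iota.
Qed.

End Cycle.

(** * The bound on cycles is attained *)

Section Count.
Variables (w : nat) (mu : nat -> nat).
Hypothesis w_gt0 : 0 < w.
Hypothesis mu_ge : forall p, p + 2 <= mu p.
Implicit Types (E : {fset nat} -> bool) (A B F X Y Z S e : {fset nat}).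
Implicit Types (G : nat -> {fset nat}) (h : nat -> nat).

Notation L := (limit w mu).

(** Over an independent set B, either cycles can be placed arbitrarily far out, hence disjointly, or
    one is refused. A refusal exhibits more than mu l copies over B; all but the refused one are in
    the limit. *)
Lemma max_copies l : 2 < l -> exists F G, #|` F| = l /\ copies w L F G (mu l).
Proof.
move=> l_gt2; pose X := cyc_new w l; pose O := cyc_old w l.
have [B [cB sB nB]] := independent_set mu w_gt0 l (l * w).
have [h h_inj hB] : exists2 h : nat -> nat, {in O &, injective h} & h @` O = B.
  by apply: bij_fset; rewrite card_old.
have prX : prim w (cyc w l) O X := prim_cyc w_gt0 l_gt2.
have baX : based (cyc w l) O X := based_cyc w_gt0 l_gt2.
have hA : iso (cyc w l) L h O.
  split=> // e eO; have /negbTE-> : ~~ L (h @` e) by apply: nB; rewrite -hB imfsetS.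
  apply/negbTE/negP => /cycP[t tl et]; have := block_start w_gt0 l_gt2 tl.
  rewrite -et => /(fsubsetP eO) so; have := fdisjointP (disj_cyc w l) _ so.
  by rewrite in_new ltn_pmul2r // tl.
have sz e : e \in newE (cyc w l) O X -> #|` e| = w.+2.
  by rewrite in_newE => /and3P[_ /cycP[t tl ->] _]; exact: (card_block w_gt0 l_gt2 tl).
have lin e1 e2 : e1 \in newE (cyc w l) O X -> e2 \in newE (cyc w l) O X ->
    1 < #|` e1 `&` e2| -> e1 = e2.
  by rewrite !in_newE => /and3P[_ c1 _] /and3P[_ c2 _]; exact: (cyc_linear w_gt0 l_gt2 c1 c2).
have lin01 e e2 : e \in newE (cyc w l) O X -> L e2 -> #|` e2 `&` h @` (e `&` O)| <= 1.
  rewrite in_newE => /and3P[_ /cycP[t tl ->] _] _.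
  apply: leq_trans (fsubset_leq_card (fsubsetIr _ _)) _.
  apply: leq_trans (leq_imfset_card _ _ _) _; rewrite -(cardfs1 (l * w + t)).
  apply/fsubset_leq_card/fsubsetP=> x; rewrite inE => /andP[xt xO].
  by move: xt; rewrite (block_old w_gt0 l_gt2 tl xO) inE.
have cX : #|` X| = l * w by exact: card_new.
have sB' : str w L #|` X| (h @` O) by rewrite hB cX.
pose P b psi := [/\ iso (cyc w l) L psi (O `|` X), {in O, psi =1 h},
  forall x, x \in X -> b <= psi x & exists n, below n (psi @` X)].
case: (pselect (forall b, exists psi, P b psi)) => [/choice[psi psiP]|].
  have /choice[n nP] : forall b, exists n, below n (psi b @` X).
    by move=> b; have [_ _ _] := psiP b.
  (* Each copy is placed above the bound of the preceding ones. *)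
  pose c i := iter i (fun b => maxn b (n b)) 0.
  have c_le i j : i <= j -> c i <= c j.
    move=> /subnK <-; elim: (j - i) => // d IH; rewrite addSn /=.
    exact: leq_trans IH (leq_maxl _ _).
  pose G i := psi (c i) @` X.
  have pO i : psi (c i) @` O = B.
    by rewrite -hB; apply: eq_in_imfset => x; have [_ H _ _] := psiP (c i); exact: H.
  have dG i j : i < j -> fdisjoint (G i) (G j).
    move=> ij; apply/fdisjointP=> x xi; apply/negP => /imfsetP[y /= yX ex].
    have [_ _ lo _] := psiP (c j); have := nP _ _ xi; rewrite ltnNge => /negP; apply.
    apply: leq_trans (_ : c j <= x); last by rewrite ex lo.
    by apply: leq_trans (c_le _ _ ij); exact: leq_maxr.
  exists B, G; split=> //; split=> [i _|i _|i j _ _ ij|i j _ _].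
  - by have [pi _ _ _] := psiP (c i); rewrite -(pO i); apply: prim_iso pi _ prX; exact: fsubset_refl.
  - by have [pi _ _ _] := psiP (c i); rewrite -(pO i); apply: based_iso pi _ baX; exact: fsubset_refl.
  - have [lt|lt|//] := ltngtP i j; first exact: dG.
    by rewrite /fdisjoint fsetIC; exact: dG.
  have [pi ei _ _] := psiP (c i); have [pj ej _ _] := psiP (c j).
  have [g gK] := imfset_linv pi.1.
  have gi := iso_inv pi gK; rewrite imfsetU pO in gi.
  have imi : g @` (B `|` G i) = O `|` X.
    by rewrite -(pO i) -imfsetU (imfset_lcan gK) ?fsubset_refl.
  exists (psi (c j) \o g); first by apply: iso_comp gi _; rewrite imi.
  split=> [x|]; last by rewrite (imfset_comp _ g (psi (c j))) (imfset_lcan gK) ?fsubsetUr.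
  rewrite -hB => /imfsetP[a /= aO ->]; have aOX : a \in O `|` X by rewrite in_fsetU aO.
  by rewrite -(ei a aO) gK // ej // ei.
move=> /existsNP[b nP].
have [i [D [psi [[bN bB] pi [psA psX] DE out]]]] := visit w_gt0 mu_ge b prX hA sz lin lin01 sB'.
case: out => [[piL [j bj]]|[F [G [r [mur cop H]]]]].
  case: nP; exists psi; split=> //; last by exists (stage w mu j).2.
  by move=> x /psX; exact: leq_trans.
rewrite hB in H bB; have [pr ba di ii] := cop.
have pO : psi @` O = B by rewrite -hB; exact: eq_in_imfset.
have dBX : fdisjoint B (psi @` X).
  by rewrite -pO (imfset_disj_in pi.1) ?fsubsetUl ?fsubsetUr //; exact: disj_cyc.
case: H => [[FB [i0 i0r Gi0]]|[f [fF fX FBX GBX]]]; last first.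
  exfalso; have [ee [eD fe eFG ne]] := copies_degree cop fF.
  move: fX => /imfsetP[x /= xX fx].
  have r3 : 2 < r by have := mu_ge #|` F|; lia.
  have tP k : k < 3 -> exists2 t, t < l & ee k = psi @` cyc_block w l t.
    move=> k3; have kr : k < r by apply: leq_trans r3.
    have sub : ee k `<=` psi @` (O `|` X).
      by rewrite imfsetU pO; apply: fsubset_trans (eFG _ kr) _; rewrite fsubUset FBX GBX.
    have eqe := imfset_preim sub; set e := [fset y in _ | _] in eqe.
    have eOX : e `<=` O `|` X by apply/fsubsetP=> y; rewrite !inE => /andP[].
    have : cyc w l e by rewrite pi.2 // -eqe eD.
    by move=> /cycP[t tl et]; exists t; rewrite // eqe et.
  have xt k t : k < 3 -> t < l -> ee k = psi @` cyc_block w l t ->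
      t = x %/ w \/ cyc_succ l t = x %/ w.
    move=> k3 tl et; apply: (block_new w_gt0 l_gt2 tl xX).
    have := fe k (leq_trans k3 r3); rewrite et fx (mem_imfset_in pi.1) //.
      by rewrite in_fsetU xX orbT.
    exact: (block_sub w_gt0 l_gt2 tl).
  (* A new point of the cycle lies on at most two of its blocks, whereas f would lie on three. *)
  have [[t0 l0 e0] [t1 l1 e1] [t2 l2 e2]] := And3 (tP 0 isT) (tP 1 isT) (tP 2 isT).
  have ne01 : t0 <> t1 by move=> et; apply: (ne 0 1) => //; [lia | lia | rewrite e0 e1 et].
  have ne02 : t0 <> t2 by move=> et; apply: (ne 0 2) => //; [lia | rewrite e0 e2 et].
  have ne12 : t1 <> t2 by move=> et; apply: (ne 1 2) => //; [lia | rewrite e1 e2 et].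
  have s_inj t t' : t < l -> t' < l -> cyc_succ l t = cyc_succ l t' -> t = t'.
    move=> tl tl'; rewrite !(cyc_succE w_gt0 l_gt2) //.
    by case: (t.+1 =P l) => ?; case: (t'.+1 =P l) => ?; lia.
  have [a0|a0] := xt 0 t0 isT l0 e0; have [a1|a1] := xt 1 t1 isT l1 e1;
    have [a2|a2] := xt 2 t2 isT l2 e2; try congruence.
  - by apply: ne12; apply: s_inj => //; rewrite a1 a2.
  - by apply: ne02; apply: s_inj => //; rewrite a0 a2.
  - by apply: ne01; apply: s_inj => //; rewrite a0 a1.
  - by apply: ne01; apply: s_inj => //; rewrite a0 a1.
have prB : prim w D B (psi @` X) by rewrite -pO; apply: prim_iso pi _ prX; exact: fsubset_refl.
have baB : based D B (psi @` X) by rewrite -pO; apply: based_iso pi _ baX; exact: fsubset_refl.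
have prF : prim w D F (psi @` X) by rewrite -Gi0; exact: pr.
(* Every point of B lies on a block of the cycle, and the blocks new over B are already new over
   F. *)
have eqF : F = B.
  apply/eqP; rewrite eqEfsubset FB /=; apply/fsubsetP=> y yB.
  have [e] := baB y yB; rewrite (newE_base w_gt0 prB prF FB) in_newE => /and3P[es _ _] /(fsubsetP es).
  by rewrite inE => /orP[//|yX]; have := fdisjointP dBX y yB; rewrite yX.
subst F; rewrite cB in mur.
(* [bump] skips the index of the refused copy, which leaves at least mu l others. *)
pose G' j := G (bump i0 j).
have br j : j < mu l -> bump i0 j < r by rewrite /bump; case: (i0 <= j) => /=; lia.
have bne j : bump i0 j <> i0 by move=> e; have := neq_bump i0 j; rewrite e eqxx.
have cop' : copies w D B G' (mu l).
  split=> [j jm|j jm|j k jm km jk|j k jm km].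
  - by apply: pr; exact: br.
  - by apply: ba; exact: br.
  - by apply: di; [exact: br | exact: br | move=> /(can_inj (@bumpK i0)); exact: jk].
  - by apply: ii; exact: br.
pose S := B `|` (\bigcup_(j <- iota 0 (mu l)) G' j)%fset.
have GS j : j < mu l -> G' j `<=` S.
  by move=> jm; apply: fsubset_trans (fsubsetUr _ _); apply: bigfcup_sup; rewrite ?mem_iota.
have SP x : x \in S -> x \in B \/ exists2 j, j < mu l & x \in G' j.
  rewrite inE => /orP[|/bigfcupP[j jm xj]]; [by left|right; exists j => //].
  by move: jm; rewrite mem_iota andbT.
have dG j : j < mu l -> fdisjoint (G' j) (psi @` X).
  by move=> jm; rewrite -Gi0; apply: di => //; exact: br.
have dS : fdisjoint S (psi @` X).
  apply/fdisjointP=> x /SP[xB|[j jm xj]]; first exact: (fdisjointP dBX).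
  exact: (fdisjointP (dG j jm)).
have subX (e : {fset nat}) : e `<=` S -> fdisjoint e (psi @` X).
  by move=> eS; apply/fdisjointP=> x /(fsubsetP eS)/(fdisjointP dS).
have copi : copies w (stage w mu i).1 B G' (mu l).
  by apply: (copies_id _ (fsubsetUl _ _) GS cop') => e /subX; exact: DE.
have [_ bd _] := stageP mu w_gt0 i.
have bS : below (stage w mu i).2 S.
  move=> x /SP[/bB//|[j jm xj]]; have [pj _ _ _] := copi.
  have [e] := prim_cover (pj j jm) xj; rewrite in_newE => /and3P[_ /bd be _]; exact: be.
exists B, G'; split=> //; apply: (copies_id _ (fsubsetUl _ _) GS copi) => e eS.
by symmetry; apply: (limit_below w_gt0) => x /(fsubsetP eS); exact: bS.
Qed.

End Count.

Lemma slack_ge (s : nat -> bool) p : p + 2 <= p + 2 + s (p - 3).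
Proof. exact: leq_addr. Qed.

Theorem theorem2p7 :
  (forall M : structure, linear_space M -> strongly_minimal M ->
     no_cofinite_line M ->
     exists (V : Type) (K : set nat), finite_set K /\ pbd V K 1 (@lines M)) /\
  (forall k : nat, (3 <= k)%N ->
     exists M : (nat -> bool) -> structure,
       (forall s : nat -> bool,
          [/\ linear_space (M s), strongly_minimal (M s) &
              steiner k (@lines (M s))]) /\
       (forall s t : nat -> bool, s <> t -> theory (M s) <> theory (M t))).
Proof.
split=> [M|[|[|w]] // w_gt0]; first exact: strongly_minimal_pbd.
(* The j-th bit is stored at p = j + 3, since cycles need length at least 3. For p < 3 the truncated
   subtraction repeats the bit 0, which does no harm. *)
pose mu (s : nat -> bool) p := p + 2 + s (p - 3).
exists (fun s => space (limit w (mu s))); split=> [s|s t st th].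
  split; first exact: space_linear.
    exact: (space_strongly_minimal w_gt0 (slack_ge s)).
  exact: (steiner_space w_gt0 (slack_ge s)).
apply: st; apply: funext => j.
(* The copies that attain the bound for [s'] transfer to the other structure, where they obey the
   bound for [t']; symmetry gives equality. *)
have le (s' t' : nat -> bool) : theory (space (limit w (mu s'))) = theory (space (limit w (mu t'))) ->
    s' j <= t' j.
  move=> th'; have [F [G [cF cop]]] := max_copies w_gt0 (slack_ge s') (isT : 2 < j.+3).
  have := theory_copies w_gt0 (slack_ge s') (slack_ge t') th' cop.
  by rewrite cF /mu !subSS subn0 leq_add2l.
by apply/eqP; move: (le s t th) (le t s (esym th)); case: (s j); case: (t j).
Qed.
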